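(* Let $\Omega=\mathbb{T}\times(-1,1)$ and let $\rho_s:(-1,1)\to\mathbb{R}$ satisfy $\rho_s'\in W^{\infty,\infty}((-1,1))$ and $\sup_{(-1,1)}\rho_s'>0$. Then the operator $L=\rho_s'(y)\,\partial_1\Delta_D^{-1}\partial_1$ has a strictly increasing sequence of positive eigenvalues $\{\lambda_k\}_{k=1}^\infty$ converging to $\sup_{(-1,1)}\rho_s'$. Moreover, for each $k\ge1$, $\lambda_k$ has a real eigenfunction of the form $w_k(x,y)=\cos(kx)\tilde w_k(y)\in H^\infty(\Omega)$.
   Context: $\mathbb{T}=\mathbb{R}/2\pi\mathbb{Z}$; coordinates $(x,y)$, $\partial_1=\partial_x$. $\Delta_D^{-1}$ is the inverse of the Laplacian on $\Omega$ with homogeneous Dirichlet condition at $y=\pm1$. $W^{\infty,\infty}$ denotes the functions all of whose derivatives of every order $\ge0$ are bounded; $H^\infty(\Omega)=\bigcap_nH^n(\Omega)$. $L$ is a bounded operator on $H^m(\Omega)$ for every $m\ge0$. *)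

(* Defs.v *)
From HB Require Import structures.
From mathcomp Require Import all_boot all_order all_algebra.
From mathcomp Require Import all_classical all_reals all_analysis.
Set Implicit Arguments.
Unset Strict Implicit.
Unset Printing Implicit Defensive.
Import Order.TTheory GRing.Theory Num.Theory.
Import numFieldNormedType.Exports.
Local Open Scope classical_set_scope.
Local Open Scope ring_scope.

(* A function on T x (-1, 1), T = R / 2 pi Z, is represented by a total
   function on the plane that is 2 pi-periodic in its first coordinate for
   -1 < y < 1; its values at |y| >= 1 are irrelevant.  [Omega] is a
   fundamental cell, over which all integrals are taken. *)
Definition Omega (R : realType) : set (R * R) :=
  `[0, 2 * pi[%classic `*` `]-1, 1[%classic.
Arguments Omega : clear implicits.

Notation area R := (@lebesgue_measure R \x @lebesgue_measure R)%E.

Definition on_Omega (R : realType) (f : R * R -> R) : Prop :=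
  forall y : R, -1 < y < 1 -> periodic (fun x => f (x, y)) (2 * pi).

Definition ae_Omega (R : realType) (P : R * R -> Prop) : Prop :=
  {ae area R, forall z, Omega R z -> P z}.

Definition L2 (R : realType) (f : R * R -> R) : Prop :=
  [/\ on_Omega f, @measurable_fun _ _ (measurableTypeR R * measurableTypeR R)%type
        (measurableTypeR R) (Omega R) f
    & (\int[area R]_(z in Omega R) ((f z) ^+ 2)%:E < +oo)%E].

Definition e1 (R : realType) : R * R := (1, 0).
Definition e2 (R : realType) : R * R := (0, 1).

Fixpoint class_C (R : realType) (n : nat) (f : R * R -> R) : Prop :=
  if n is m.+1 then
    [/\ forall z, derivable f z (e1 R), forall z, derivable f z (e2 R),
        class_C m (fun z => 'D_(e1 R) f z)
      & class_C m (fun z => 'D_(e2 R) f z)]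
  else continuous f.

(* C_c^oo(T x (-1, 1)), extended by zero to |y| >= 1.  As T is compact, only
   the y-extent of the support is constrained. *)
Definition test_function (R : realType) (phi : R * R -> R) : Prop :=
  [/\ forall n, class_C n phi,
      forall y, periodic (fun x => phi (x, y)) (2 * pi)
    & exists2 d : R, 0 < d & forall x y, 1 - d < `|y| -> phi (x, y) = 0].

(* Distributions on T x (-1, 1); only their values on test functions matter. *)
Definition distribution (R : realType) : Type := (R * R -> R) -> R.

Definition distr_eq (R : realType) (S T : distribution R) : Prop :=
  forall phi, test_function phi -> S phi = T phi.

Definition distr_of (R : realType) (f : R * R -> R) : distribution R :=
  fun phi => \int[area R]_(z in Omega R) (f z * phi z).

Definition distr_partial (R : realType) (v : R * R) (T : distribution R) :
    distribution R :=
  fun phi => - T (fun z => 'D_v phi z).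

Definition distr_laplacian (R : realType) (T : distribution R) :
    distribution R :=
  fun phi => distr_partial (e1 R) (distr_partial (e1 R) T) phi
           + distr_partial (e2 R) (distr_partial (e2 R) T) phi.

Definition weak_derivative (R : realType) (a b : nat) (f g : R * R -> R) :
    Prop :=
  distr_eq (iter a (distr_partial (e1 R))
             (iter b (distr_partial (e2 R)) (distr_of f)))
           (distr_of g).

Definition sobolev (R : realType) (n : nat) (f : R * R -> R) : Prop :=
  L2 f /\ forall a b : nat, (a + b <= n)%N ->
    exists2 g, L2 g & weak_derivative a b f g.

Definition sobolev_oo (R : realType) (f : R * R -> R) : Prop :=
  forall n, sobolev n f.

(* H^1_0: the closure of the test functions in the H^1 norm. *)
Definition sobolev10 (R : realType) (f : R * R -> R) : Prop :=
  L2 f /\ exists f1 f2 : R * R -> R,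
    [/\ L2 f1, weak_derivative 1 0 f f1, L2 f2, weak_derivative 0 1 f f2
      & forall e : R, 0 < e -> exists2 phi, test_function phi &
          (\int[area R]_(z in Omega R)
             ((f z - phi z) ^+ 2 + (f1 z - 'D_(e1 R) phi z) ^+ 2
              + (f2 z - 'D_(e2 R) phi z) ^+ 2)%:E < e%:E)%E].

(* [psi] is Delta_D^{-1} T: the solution in H^1_0 of Delta psi = T, which is
   unique up to a null set. *)
Definition dirichlet_inverse (R : realType) (T : distribution R)
    (psi : R * R -> R) : Prop :=
  sobolev10 psi /\ distr_eq (distr_laplacian (distr_of psi)) T.

(* The graph of L = rho'(y) d_1 Delta_D^{-1} d_1 in L^2 x L^2.  The inner d_1
   is distributional, so that w need not be differentiable. *)
Definition L_graph (R : realType) (rho : R -> R) (w v : R * R -> R) : Prop :=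
  [/\ L2 w, L2 v & exists psi q : R * R -> R,
    [/\ dirichlet_inverse (distr_partial (e1 R) (distr_of w)) psi,
        L2 q, weak_derivative 1 0 psi q
      & ae_Omega (fun z => v z = derive1 rho z.2 * q z)]].

Definition L_eigenfunction (R : realType) (rho : R -> R) (lambda : R)
    (w : R * R -> R) : Prop :=
  ~ ae_Omega (fun z => w z = 0) /\ L_graph rho w (fun z => lambda * w z).

Definition L_eigenvalue (R : realType) (rho : R -> R) (lambda : R) : Prop :=
  exists w, L_eigenfunction rho lambda w.

(* W^{oo,oo}((-1, 1)); the values of f outside (-1, 1) are irrelevant. *)
Definition W_oo_oo (R : realType) (f : R -> R) : Prop :=
  forall n : nat,
    (forall y : R, -1 < y < 1 -> derivable (derive1n n f) y 1) /\
    exists M : R, forall y : R, -1 < y < 1 -> `|derive1n n f y| <= M.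

(* Main.v *)
(** Separating variables, [w = cos (k x) wt y] is an eigenfunction of [L] for
    [lambda] as soon as [psi = sin (k x) phi y], where [phi] is a Dirichlet
    eigenfunction of [phi'' = k^2 (1 - rho' / lambda) phi] on [(-1, 1)] and
    [wt = (k / lambda) rho' phi].  For [m = 1 / lambda], shoot from [-1] with
    slope 1: the least [m] for which the solution is not positive on [(-1, 1]]
    has a solution that is positive inside and vanishes at 1, which gives
    [lambda k].  Convexity of the solution yields [lambda k <= sup rho'];
    comparison with a sine on an interval where [rho'] is close to its supremum
    yields the convergence; Picone's identity yields strict monotonicity in
    [k].  Since [phi] is smooth up to the boundary, the distributional
    statements follow from Fubini and one-dimensional integration by parts,
    and [psi] lies in [H^1_0] by smooth cutoffs in [y], because [phi] vanishes
    linearly at the ends. *)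

Require Import Defs.
From mathcomp Require Import all_boot all_order all_algebra.
From mathcomp Require Import all_classical all_reals all_analysis.
From mathcomp Require Import measurable_realfun ring lra.
Import Order.TTheory GRing.Theory Num.Theory.
Import numFieldNormedType.Exports.
Local Open Scope classical_set_scope.
Local Open Scope ring_scope.
Set Implicit Arguments.
Unset Strict Implicit.

(** * Derivatives and smooth functions of one variable *)

(** Hence the critical parameter is taken as an infimum, and what is carried along is its
    minimality: every positive [m] below it gives shots positive up to and including 1. Monotonicity
    in [k] and convergence both come from this, by testing one wave number at the parameter of
    another, or at [1 / l] with [l] slightly below the supremum. Picone's identity can then compare
    two wave numbers at one and the same [m]: once the equations are divided by the squared wave
    numbers, both have the coefficient [1 - m rho']. The other obstacle is the boundary. [rho'] is
    controlled only on the open interval, so the equation holds only there, while the shot and its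
    slope are continuous up to the ends. The quotient in Picone's identity is [0 / 0] at -1 and
    possibly at 1; it is controlled by linear lower bounds on the denominator, which rest on the
    fact that a shot and its slope never vanish together. *)

Section is_derive_rules.
Context {R : realType}.
Implicit Types (f g : R -> R) (x df dg : R).

Lemma is_derive1_add f g x df dg : is_derive x (1 : R) f df ->
  is_derive x (1 : R) g dg -> is_derive x (1 : R) (fun t => f t + g t) (df + dg).
Proof. exact: is_deriveD. Qed.

Lemma is_derive1_opp f x df : is_derive x (1 : R) f df ->
  is_derive x (1 : R) (fun t => - f t) (- df).
Proof. exact: is_deriveN. Qed.

Lemma is_derive1_sub f g x df dg : is_derive x (1 : R) f df ->
  is_derive x (1 : R) g dg -> is_derive x (1 : R) (fun t => f t - g t) (df - dg).
Proof. exact: is_deriveB. Qed.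

Lemma is_derive1_mul f g x df dg : is_derive x (1 : R) f df ->
  is_derive x (1 : R) g dg ->
  is_derive x (1 : R) (fun t => f t * g t) (df * g x + f x * dg).
Proof.
move=> hf hg; apply: (is_derive_eq (is_deriveM hf hg)).
by rewrite /GRing.scale /= addrC mulrC.
Qed.

Lemma is_derive1_exprn f n x df : is_derive x (1 : R) f df ->
  is_derive x (1 : R) (fun t => f t ^+ n) (n%:R * f x ^+ n.-1 * df).
Proof.
move=> hf; elim: n => [|n IH].
  by rewrite !mul0r; exact: is_derive_cst.
have -> : (fun t => f t ^+ n.+1) = (fun t => f t * f t ^+ n).
  by apply/funext => t; rewrite exprS.
apply: (is_derive_eq (is_derive1_mul hf IH)).
case: n {IH} => [|n] /=; first by rewrite !expr0; ring.
by rewrite !exprS; ring.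
Qed.

Lemma is_derive1_inv f x df : is_derive x (1 : R) f df -> f x != 0 ->
  is_derive x (1 : R) (fun t => (f t)^-1) (- df / (f x) ^+ 2).
Proof.
move=> [hf <-] fx0; apply: DeriveDef; first exact: derivableV.
by rewrite deriveV // /GRing.scale /= mulNr mulNr mulrC.
Qed.

Lemma is_derive1_comp_rule f g x df dg : is_derive x (1 : R) f df ->
  is_derive (f x) (1 : R) g dg ->
  is_derive x (1 : R) (fun t => g (f t)) (dg * df).
Proof. by move=> hf hg; exact: is_derive1_comp. Qed.

Lemma is_derive1_affine a b x : is_derive x (1 : R) (fun t => a * t + b) a.
Proof.
have h := is_derive1_add (is_derive1_mul (is_derive_cst a x (1 : R))
  (is_derive_id x (1 : R))) (is_derive_cst b x (1 : R)).
have e : 0 * x + a * 1 + 0 = a by rewrite mul0r add0r addr0 mulr1.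
by rewrite -[X in is_derive _ _ _ X]e; exact: h.
Qed.

Lemma is_derive1_derive1 f x df : is_derive x (1 : R) f df -> f^`()%classic x = df.
Proof. by rewrite derive1E => -[]. Qed.

Lemma derivable_is_derive f x : derivable f x 1 ->
  is_derive x (1 : R) f (f^`()%classic x).
Proof. by move=> h; rewrite derive1E; apply: DeriveDef. Qed.

Lemma is_derive1_continuous f x df : is_derive x (1 : R) f df ->
  {for x, continuous f}.
Proof.
by move=> [h _]; exact/differentiable_continuous/derivable1_diffP.
Qed.

Lemma is_derive1_eq_on (A : set R) f g x df : open A -> A x ->
  (forall y, A y -> f y = g y) -> is_derive x (1 : R) f df ->
  is_derive x (1 : R) g df.
Proof.
move=> oA Ax fg; apply: near_eq_is_derive.
by apply: filterS (open_nbhs_nbhs (conj oA Ax)) => y; exact: fg.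
Qed.

End is_derive_rules.

Section Ck.
Context {R : realType}.
Implicit Types (A : set R) (b : bool) (n : nat) (f g : R -> R).

(** The flag separates two uses: functions of [y] on []-1, 1[] are kept bounded with all their
    derivatives, so that their tensors are square integrable, whereas steps and trigonometric
    functions live on the whole line with [b = false]. *)
Definition C0 A b f := (forall x, A x -> {for x, continuous f}) /\
  (b -> exists M, forall x, A x -> `|f x| <= M).

(* [b] requires in addition that the derivatives be bounded on [A]. *)
Fixpoint Ck A b n f : Prop := C0 A b f /\
  if n is m.+1 then
    (forall x, A x -> derivable f x 1) /\ Ck A b m f^`()%classic
  else True.

Lemma Ck_C0 A b n f : Ck A b n f -> C0 A b f.
Proof. by case: n => [|n] []. Qed.

Lemma Ck_pred A b n f : Ck A b n.+1 f -> Ck A b n f.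
Proof.
elim: n f => [|n IH] f [h0 [hd hf]]; first by split.
by split=> //; split=> //; exact: IH.
Qed.

Lemma C0_eq A b f g : open A -> (forall x, A x -> f x = g x) ->
  C0 A b f -> C0 A b g.
Proof.
move=> oA fg [cf bf]; split=> [x Ax|hb].
  rewrite /prop_for /continuous_at -(fg _ Ax); apply: cvg_trans (cf _ Ax).
  apply: near_eq_cvg; apply: filterS (open_nbhs_nbhs (conj oA Ax)) => y Ay /=.
  by rewrite fg.
by have [M hM] := bf hb; exists M => x Ax; rewrite -fg //; exact: hM.
Qed.

Lemma Ck_eq A b n f g : open A -> (forall x, A x -> f x = g x) ->
  Ck A b n f -> Ck A b n g.
Proof.
move=> oA; elim: n f g => [|n IH] f g fg [h0 h]; split=> //.
- exact: C0_eq h0.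
- exact: C0_eq h0.
- have [hd hf] := h; split=> [x Ax|].
    by have [] := is_derive1_eq_on oA Ax fg (derivable_is_derive (hd x Ax)).
  apply: IH hf => x Ax.
  by rewrite (is_derive1_derive1 (is_derive1_eq_on oA Ax fg (derivable_is_derive (hd x Ax)))).
Qed.

Lemma CkS A b n f g : open A -> C0 A b f ->
  (forall x, A x -> is_derive x (1 : R) f (g x)) -> Ck A b n g -> Ck A b n.+1 f.
Proof.
move=> oA h0 fg hg; split=> //; split=> [x /fg []//|].
by apply: Ck_eq hg => // x /fg /is_derive1_derive1.
Qed.

Lemma Ck_is_derive A b n f x : Ck A b n.+1 f -> A x ->
  is_derive x (1 : R) f (f^`()%classic x).
Proof. by move=> [_ [h _]] /h; exact: derivable_is_derive. Qed.

Lemma Ck_derive A b n f : Ck A b n.+1 f -> Ck A b n f^`()%classic.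
Proof. by move=> [_ []]. Qed.

Lemma C0D A b f g : C0 A b f -> C0 A b g -> C0 A b (fun x => f x + g x).
Proof.
move=> [cf bf] [cg bg]; split=> [x Ax|hb].
  by apply: continuousD; [exact: cf|exact: cg].
have [M hM] := bf hb; have [N hN] := bg hb; exists (M + N) => x Ax.
by rewrite (le_trans (ler_normD _ _)) // lerD ?hM ?hN.
Qed.

Lemma C0M A b f g : C0 A b f -> C0 A b g -> C0 A b (fun x => f x * g x).
Proof.
move=> [cf bf] [cg bg]; split=> [x Ax|hb].
  by apply: continuousM; [exact: cf|exact: cg].
have [M hM] := bf hb; have [N hN] := bg hb; exists (M * N) => x Ax.
by rewrite normrM ler_pM ?hM ?hN.
Qed.

Lemma Ck_cst A b n (c : R) : open A -> Ck A b n (fun=> c).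
Proof.
move=> oA; elim: n c => [|n IH] c; have h0 : C0 A b (fun=> c) by
  split=> [x _|_]; [exact: cvg_cst|exists `|c|].
  by split.
apply: CkS (IH 0) => // x _; exact: is_derive_cst.
Qed.

Lemma CkD A b n f g : open A -> Ck A b n f -> Ck A b n g ->
  Ck A b n (fun x => f x + g x).
Proof.
move=> oA; elim: n f g => [|n IH] f g hf hg.
  by split=> //; apply: C0D; [exact: Ck_C0 hf|exact: Ck_C0 hg].
have dfg x (Ax : A x) := is_derive1_add (Ck_is_derive hf Ax) (Ck_is_derive hg Ax).
exact: (CkS oA (C0D (Ck_C0 hf) (Ck_C0 hg)) dfg (IH _ _ (Ck_derive hf) (Ck_derive hg))).
Qed.

Lemma CkM A b n f g : open A -> Ck A b n f -> Ck A b n g ->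
  Ck A b n (fun x => f x * g x).
Proof.
move=> oA; elim: n f g => [|n IH] f g hf hg.
  by split=> //; apply: C0M; [exact: Ck_C0 hf|exact: Ck_C0 hg].
have dfg x (Ax : A x) := is_derive1_mul (Ck_is_derive hf Ax) (Ck_is_derive hg Ax).
have h1 := IH _ _ (Ck_derive hf) (Ck_pred hg).
have h2 := IH _ _ (Ck_pred hf) (Ck_derive hg).
exact: (CkS oA (C0M (Ck_C0 hf) (Ck_C0 hg)) dfg (CkD oA h1 h2)).
Qed.

Lemma Ck_inv n f : (forall x, f x != 0) -> Ck setT false n f ->
  Ck setT false n (fun x => (f x)^-1).
Proof.
have oT : open [set: R] by exact: openT.
move=> f0; elim: n => [|n IH] hf; have h0 : C0 setT false (fun x => (f x)^-1) by
  split=> // x _; apply: continuousV => //; exact: (Ck_C0 hf).1.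
  by split.
have dV x (_ : setT x) : is_derive x (1 : R) (fun x => (f x)^-1)
    (-1 * (f^`()%classic x * ((f x)^-1 * (f x)^-1))).
  apply: (is_derive_eq (is_derive1_inv (Ck_is_derive hf I) (f0 x))).
  by rewrite mulN1r mulNr expr2 invfM.
have hi := IH (Ck_pred hf).
exact: (CkS oT h0 dV (CkM oT (Ck_cst _ _ _ oT) (CkM oT (Ck_derive hf) (CkM oT hi hi)))).
Qed.

Lemma Ck_affine n f (c d : R) : Ck setT false n f ->
  Ck setT false n (fun x => f (c * x + d)).
Proof.
have oT : open [set: R] by exact: openT.
elim: n f => [|n IH] f hf; have h0 : C0 setT false (fun x => f (c * x + d)) by
  split=> // x _; apply: continuous_comp (is_derive1_continuous (is_derive1_affine c d x)) _;
  exact: (Ck_C0 hf).1.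
  by split.
have df x (_ : setT x) := is_derive1_comp_rule (is_derive1_affine c d x)
  (Ck_is_derive (x := c * x + d) hf I).
exact: (CkS oT h0 df (CkM oT (IH _ (Ck_derive hf)) (Ck_cst _ _ _ oT))).
Qed.

End Ck.

(** * A smooth step built from [exp (- 1 / x)] *)

Section smooth_step.
Context {R : realType}.

(** The exponent is a parameter because the derivative of a member of this family is a linear
    combination of members; smoothness is then an induction on the order. *)
Definition flat n (x : R) : R := if 0 < x then x^-1 ^+ n * expR (- x^-1) else 0.

(** The exponential series gives [t^(n+2) / (n+2)! <= exp t] at [t = 1 / x]. A quadratic bound is
    what makes the derivative at 0 vanish. *)
Lemma flat_bound n (x : R) : `|flat n x| <= n.+2`!%:R * x ^+ 2.
Proof.
rewrite /flat; case: ltP => [x0|_]; last by rewrite normr0 mulr_ge0 // sqr_ge0.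
have t0 : 0 <= x^-1 by rewrite invr_ge0 ltW.
rewrite ger0_norm ?mulr_ge0 ?exprn_ge0 ?expR_ge0 // expRN.
have := expR_ge1Dxn n.+1 t0 => h.
have f0 : 0 < (n.+2`!%:R : R) by rewrite ltr0n fact_gt0.
have h2 : x^-1 ^+ n.+2 <= n.+2`!%:R * expR x^-1.
  by rewrite mulrC -ler_pdivrMr //; apply: le_trans h; rewrite lerDr ler01.
rewrite ler_pdivrMr ?expR_gt0 //.
have -> : x^-1 ^+ n = x ^+ 2 * x^-1 ^+ n.+2.
  rewrite -[n.+2]addn2 exprD mulrCA -exprMn mulfV ?gt_eqF //.
  by rewrite expr1n mulr1.
rewrite [leRHS]mulrAC [leRHS]mulrC; apply: ler_wpM2l => //; exact: sqr_ge0.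
Qed.

Lemma is_derive_flat n (x : R) :
  is_derive x (1 : R) (flat n) (flat n.+2 x - n%:R * flat n.+1 x).
Proof.
have [x0|x0|->] := ltgtP x 0.
- have -> : flat n.+2 x - n%:R * flat n.+1 x = 0.
    by rewrite /flat !ltNge !(ltW x0) /= mulr0 subr0.
  apply: (@is_derive1_eq_on _ [set y | y < 0] (fun=> 0)).
  + exact: open_lt.
  + exact: x0.
  + by move=> y /= y0; rewrite /flat ltNge (ltW y0).
- apply: (@is_derive1_eq_on _ [set y | 0 < y]
    (fun y => y^-1 ^+ n * expR (- y^-1))).
  + exact: open_gt.
  + exact: x0.
  + by move=> y /= y0; rewrite /flat y0.
  + have xn0 : x != 0 by rewrite gt_eqF.
    have dV : is_derive x (1 : R) (fun y => y^-1) (- x^-1 ^+ 2).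
      apply: (is_derive_eq (is_derive1_inv (is_derive_id x 1) xn0)).
      by rewrite mulN1r exprVn.
    have dX : is_derive x (1 : R) (fun y => y^-1 ^+ n)
        (n%:R * x^-1 ^+ n.-1 * (- x^-1 ^+ 2)).
      exact: is_derive1_exprn.
    have dE : is_derive x (1 : R) (fun y => expR (- y^-1))
        (expR (- x^-1) * (- - x^-1 ^+ 2)).
      exact: is_derive1_comp_rule (is_derive1_opp dV) (is_derive_expR _).
    apply: (is_derive_eq (is_derive1_mul dX dE)).
    rewrite /flat x0; case: n {dX} => [|n] /=.
      by rewrite !mul0r subr0 expr0 add0r opprK !mul1r mulrC.
    set e := expR _; set t := x^-1.
    rewrite !exprS; ring.
- have -> : flat n.+2 0 - n%:R * flat n.+1 0 = 0 :> R.
    by rewrite /flat ltxx mulr0 subr0.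
  have cv : (fun h : R => h^-1 *: (flat n (h *: (1:R) + 0) - flat n 0)) h @[h --> 0^'] --> (0 : R).
    apply/cvgrPdist_le => e e0.
    have F0 : 0 < (n.+2`!%:R : R) by rewrite ltr0n fact_gt0.
    near=> h.
    have h0 : h != 0 by near: h; exact: nbhs_dnbhs_neq.
    rewrite sub0r normrN addr0 [X in flat n X]mulr1 /flat ltxx subr0 -/(flat n h).
    rewrite /GRing.scale /= normrM normfV.
    rewrite ler_pdivrMl ?normr_gt0 //.
    apply: le_trans (flat_bound n h) _.
    rewrite -[h ^+ 2]ger0_norm ?sqr_ge0 // normrX expr2 mulrCA.
    rewrite ler_wpM2l //.
    rewrite mulrC -ler_pdivlMr //.
    near: h; apply: dnbhs0_le; exact: divr_gt0.
  apply: DeriveDef; first by apply/cvg_ex; exists 0.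
  exact: (cvg_lim _ cv).
Unshelve. all: by end_near. Qed.

Lemma Ck_flat m n : Ck setT false m (flat n).
Proof.
elim: m n => [|m IH] n; have h0 : C0 setT false (flat n) by
  split=> // x _; exact: is_derive1_continuous (is_derive_flat n x).
  by split.
have oT : open [set: R] by exact: openT.
have df x (_ : setT x) : is_derive x (1 : R) (flat n) (flat n.+2 x + (- n%:R) * flat n.+1 x).
  by rewrite mulNr; exact: is_derive_flat.
exact: (CkS oT h0 df (CkD oT (IH _) (CkM oT (Ck_cst _ _ _ oT) (IH _)))).
Qed.

Lemma flat0_ge0 (x : R) : 0 <= flat 0 x.
Proof. by rewrite /flat; case: ifP => // _; rewrite expr0 mul1r expR_ge0. Qed.

Lemma flat0_gt0 (x : R) : 0 < x -> 0 < flat 0 x.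
Proof. by rewrite /flat => ->; rewrite expr0 mul1r expR_gt0. Qed.

Lemma flat0_eq0 (x : R) : x <= 0 -> flat 0 x = 0.
Proof. by rewrite /flat ltNge => ->. Qed.

(** The transition takes place on [[1, 2]], away from 0, so that [step (n * d)] vanishes for every
    distance [d <= 1 / n]. The denominator is positive because every [t] satisfies [1 < t] or
    [t < 2]. *)
Definition step (t : R) : R :=
  flat 0 (t - 1) * (flat 0 (t - 1) + flat 0 (2 - t))^-1.

Let denom_gt0 (t : R) : 0 < flat 0 (t - 1) + flat 0 (2 - t).
Proof.
have [t1|t1] := ltP 1 t.
  by rewrite ltr_pwDl ?flat0_ge0 // flat0_gt0 // subr_gt0.
rewrite ltr_wpDl ?flat0_ge0 // flat0_gt0 //; lra.
Qed.

Lemma Ck_step n : Ck setT false n step.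
Proof.
have oT : open [set: R] by exact: openT.
have h1 : Ck setT false n (fun t : R => flat 0 (t - 1)).
  apply: Ck_eq (Ck_affine 1 (-1) (Ck_flat n 0)) => // x _ /=.
  by rewrite mul1r.
have h2 : Ck setT false n (fun t : R => flat 0 (2 - t)).
  apply: Ck_eq (Ck_affine (-1) 2 (Ck_flat n 0)) => // x _ /=.
  by rewrite mulN1r addrC.
apply: CkM => //; apply: Ck_inv; last exact: CkD.
by move=> x; rewrite gt_eqF.
Qed.

Lemma step_ge0 t : 0 <= step t.
Proof. by rewrite mulr_ge0 ?flat0_ge0 // invr_ge0 ltW. Qed.

Lemma step_le1 t : step t <= 1.
Proof. by rewrite ler_pdivrMr // mul1r lerDl flat0_ge0. Qed.

Lemma step_eq0 t : t <= 1 -> step t = 0.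
Proof. by move=> t1; rewrite /step flat0_eq0 ?mul0r // subr_le0. Qed.

Lemma step_eq1 t : 2 <= t -> step t = 1.
Proof.
move=> t2; have := denom_gt0 t; rewrite /step [flat 0 (2 - t)]flat0_eq0 ?subr_le0 //.
by rewrite addr0 => /gt_eqF /negbT /mulfV.
Qed.

End smooth_step.

(** * A linear second-order initial value problem *)

Section primitive.
Context {R : realType}.
Implicit Types (f g F : R -> R) (x y L C : R).
Notation mu := (@lebesgue_measure R).

Lemma integral_is_derive F f a b : a < b ->
  (forall x, a <= x <= b -> is_derive x (1 : R) F (f x)) ->
  (forall x, a <= x <= b -> {for x, continuous f}) ->
  (\int[mu]_(t in `[a, b]) (f t)%:E = (F b - F a)%:E)%E.
Proof.
move=> ab dF cf; rewrite (@continuous_FTC2 _ f F) //.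
- apply: continuous_in_subspaceT => x /[!inE] /=; rewrite in_itv; exact: cf.
- have cF x : a <= x <= b -> {for x, continuous F}.
    by move=> /dF /is_derive1_continuous.
  split.
  + by move=> x; rewrite in_itv /= => /andP[ax xb]; have [] := dF x; rewrite // !ltW.
  + by apply: cvg_at_right_filter; apply: cF; rewrite lexx ltW.
  + by apply: cvg_at_left_filter; apply: cF; rewrite lexx ltW.
- move=> x; rewrite in_itv /= => /andP[ax xb].
  by apply/is_derive1_derive1/dF; rewrite !ltW.
Qed.

Lemma Rintegral_is_derive F f a b : a <= b ->
  (forall x, a <= x <= b -> is_derive x (1 : R) F (f x)) ->
  (forall x, a <= x <= b -> {for x, continuous f}) ->
  \int[mu]_(t in `[a, b]) f t = F b - F a.
Proof.
rewrite le_eqVlt => /predU1P[<-|ab] dF cf.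
  by rewrite set_itv1 Rintegral_set1 subrr.
by rewrite /Rintegral (integral_is_derive ab dF cf).
Qed.

Definition prim f y : R := \int[mu]_(t in `[-1, y]) f t.

(* In this weighted norm [prim] has norm at most [1 / L], so the Picard
   iteration contracts for large [L] without any restriction on the interval. *)
Definition exp_bounded L C f :=
  measurable_fun setT f /\ forall t, `|f t| <= C * expR (L * t).

Lemma exp_bounded_ge0 L C f : exp_bounded L C f -> 0 <= C.
Proof.
move=> [_ /(_ 0)]; rewrite mulr0 expR0 mulr1; exact: le_trans.
Qed.

Lemma exp_bounded_integrable L C f a b : 0 <= L -> exp_bounded L C f ->
  mu.-integrable `[a, b] (EFin \o f).
Proof.
move=> L0 hf; have C0 := exp_bounded_ge0 hf; have [mf bf] := hf.
apply: measurable_bounded_integrable => //.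
- rewrite [X in (X < _)%E](_ : _ = mu [set` `[a, b]]) // lebesgue_measure_itv /=.
  by case: ifP => _ //; rewrite -EFinB ltry.
- exact: measurable_funTS.
- exists (C * expR (L * b)); split; first exact: num_real.
  move=> M hM x /=; rewrite in_itv /= => /andP[_ xb].
  apply: le_trans (bf x) _; apply: le_trans (ltW hM).
  by rewrite ler_wpM2l // ler_expR ler_wpM2l.
Qed.

Lemma is_derive_exp_weight L C x :
  is_derive x (1 : R) (fun t => C * expR (L * t)) (L * C * expR (L * x)).
Proof.
have h1 : is_derive x (1 : R) (fun t => expR (L * t + 0)) (expR (L * x + 0) * L).
  exact: is_derive1_comp_rule (is_derive1_affine L 0 x) (is_derive_expR _).
have := is_derive1_mul (is_derive_cst C x (1 : R)) h1.
under eq_fun do rewrite addr0.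
rewrite addr0 mul0r add0r => h2; apply: (is_derive_eq h2).
by rewrite /cst; ring.
Qed.

Lemma exp_weight_bounded L C : 0 <= C -> exp_bounded L C (fun t => C * expR (L * t)).
Proof.
move=> C0; split.
  apply: continuous_measurable_fun => x.
  exact: is_derive1_continuous (is_derive_exp_weight L C x).
by move=> t; rewrite ger0_norm // mulr_ge0 // expR_ge0.
Qed.

Lemma exp_boundedS L C D f : C <= D -> exp_bounded L C f -> exp_bounded L D f.
Proof.
move=> CD [mf bf]; split=> // t; apply: le_trans (bf t) _.
by rewrite ler_wpM2r // expR_ge0.
Qed.

Lemma exp_boundedD L C D f g : exp_bounded L C f -> exp_bounded L D g ->
  exp_bounded L (C + D) (fun t => f t + g t).
Proof.
move=> [mf bf] [mg bg]; split; first exact: measurable_funD.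
by move=> t; rewrite mulrDl (le_trans (ler_normD _ _)) // lerD.
Qed.

Lemma exp_boundedM L C (M : R) (q : R -> R) f : measurable_fun setT q -> (forall t, `|q t| <= M) ->
  exp_bounded L C f -> exp_bounded L (M * C) (fun t => q t * f t).
Proof.
move=> mq bq [mf bf]; split; first exact: measurable_funM.
by move=> t; rewrite normrM -mulrA ler_pM.
Qed.

Lemma primD L C D f g y : 0 <= L -> exp_bounded L C f -> exp_bounded L D g ->
  prim (fun t => f t + g t) y = prim f y + prim g y.
Proof.
move=> L0 hf hg; rewrite /prim RintegralD //.
- exact: exp_bounded_integrable hf.
- exact: exp_bounded_integrable hg.
Qed.

Lemma prim_lt f y : y < -1 -> prim f y = 0.
Proof. by move=> y1; rewrite /prim set_itv_ge ?Rintegral_set0 // bnd_simp -ltNge. Qed.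

Lemma prim_init f : prim f (-1) = 0.
Proof. by rewrite /prim set_itv1 Rintegral_set1. Qed.

Lemma prim_bound L C f y : 0 < L -> exp_bounded L C f ->
  `|prim f y| <= C / L * expR (L * y).
Proof.
move=> L0 hf; have C0 := exp_bounded_ge0 hf; have [mf bf] := hf.
have CL : 0 <= C / L by rewrite divr_ge0 // ltW.
have [y1|y1] := ltP y (-1).
  by rewrite prim_lt // normr0 mulr_ge0 // expR_ge0.
have he := exp_weight_bounded L C0.
apply: le_trans (le_normr_Rintegral _ (exp_bounded_integrable _ _ (ltW L0) hf)) _ => //.
apply: (@le_trans _ _ (\int[mu]_(t in `[-1, y]) (C * expR (L * t)))).
  apply: le_Rintegral => //.
  - exact/integrable_norm/(exp_bounded_integrable _ _ (ltW L0) hf).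
  - exact: (exp_bounded_integrable _ _ (ltW L0) he).
have dE x : is_derive x (1 : R) (fun t => C / L * expR (L * t)) (C * expR (L * x)).
  apply: (is_derive_eq (is_derive_exp_weight L (C / L) x)).
  by rewrite mulrCA mulfV ?mulr1 // gt_eqF.
rewrite (Rintegral_is_derive y1 (fun x _ => dE x)).
- by rewrite gerBl mulr_ge0 // expR_ge0.
- by move=> x _; exact: is_derive1_continuous (is_derive_exp_weight L C x).
Qed.

Lemma prim_lipschitz L C f x y : 0 <= L -> exp_bounded L C f -> x <= y ->
  `|prim f y - prim f x| <= C * expR (L * y) * (y - x).
Proof.
move=> L0 hf xy; have C0 := exp_bounded_ge0 hf; have [mf bf] := hf.
have P0 : 0 <= C * expR (L * y) by rewrite mulr_ge0 // expR_ge0.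
have key u : -1 <= u -> u <= y ->
  `|prim f y - prim f u| <= C * expR (L * y) * (y - u).
  move=> u1 uy; rewrite /prim Rintegral_itvB ?bnd_simp //; last first.
    exact: (exp_bounded_integrable _ _ L0 hf).
  have hi : mu.-integrable `]u, y] (EFin \o f).
    apply: integrableS (exp_bounded_integrable u y L0 hf) => //.
    by apply: subset_itvr; rewrite bnd_simp.
  apply: le_trans (le_normr_Rintegral _ hi) _ => //.
  apply: (@le_trans _ _ (\int[mu]_(t in `]u, y]) (C * expR (L * y)))).
    apply: le_Rintegral => //.
    - exact/integrable_norm.
    - apply: measurable_bounded_integrable => //.
      + rewrite [X in (X < _)%E](_ : _ = mu [set` `]u, y]]) // lebesgue_measure_itv /=.
        by case: ifP => _ //; rewrite -EFinB ltry.
      + exists (C * expR (L * y)); split; first exact: num_real.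
        by move=> M hM t _ /=; rewrite ger0_norm // ltW.
    - move=> t; rewrite /= in_itv /= => /andP[_ ty].
      apply: le_trans (bf t) _.
      by rewrite ler_wpM2l // ler_expR ler_wpM2l.
  rewrite Rintegral_cst // [X in fine X](_ : _ = mu [set` `]u, y]]) // lebesgue_measure_itv /=.
  by case: ifPn => // _; rewrite /= mulr0 mulr_ge0 // subr_ge0.
have [x1|x1] := leP (-1) x; first exact: key.
have [y1|y1] := ltP y (-1).
  by rewrite !prim_lt // subrr normr0 mulr_ge0 // subr_ge0.
rewrite (prim_lt f x1) -(prim_init f); apply: le_trans (key _ _ y1) _ => //.
by rewrite ler_wpM2l // lerB // ltW.
Qed.

Lemma prim_continuous L C f : 0 <= L -> exp_bounded L C f -> continuous (prim f).
Proof.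
move=> L0 hf x; have C0 := exp_bounded_ge0 hf.
apply/cvgrPdist_le => e e0.
set K := C * expR (L * (x + 1)) + 1.
have K0 : 0 < K by rewrite ltr_wpDl // mulr_ge0 // expR_ge0.
have main u v : u <= v -> v <= x + 1 -> `|prim f v - prim f u| <= K * (v - u).
  move=> uv vx; apply: le_trans (prim_lipschitz L0 hf uv) _.
  rewrite ler_wpM2r ?subr_ge0 // /K ler_wpDr // ler_wpM2l // ler_expR.
  by rewrite ler_wpM2l.
near=> y.
have hy : `|x - y| <= e / K.
  near: y; apply: cvgr_dist_le; first exact: cvg_id.
  exact: divr_gt0.
have hy1 : y <= x + 1.
  apply: ltW.
  by near: y; apply: lt_nbhsl; rewrite ltrDl.
have hK : K * `|x - y| <= e by rewrite mulrC -ler_pdivlMr.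
have [xy|yx] := leP x y.
  rewrite distrC; apply: le_trans (main _ _ xy hy1) _.
  by rewrite -[y - x]ger0_norm ?subr_ge0 // distrC.
apply: le_trans (main _ _ (ltW yx) _) _; first by rewrite lerDl.
by rewrite -[x - y]ger0_norm ?subr_ge0 // ltW.
Unshelve. all: by end_near. Qed.

Lemma prim_exp_bounded L C f : 0 < L -> exp_bounded L C f ->
  exp_bounded L (C / L) (prim f).
Proof.
move=> L0 hf; split; last by move=> t; exact: prim_bound.
by apply: continuous_measurable_fun; apply: prim_continuous hf; exact: ltW.
Qed.

Lemma is_derive_prim L C f x : 0 <= L -> exp_bounded L C f -> -1 < x ->
  {for x, continuous f} -> is_derive x (1 : R) (prim f) (f x).
Proof.
move=> L0 hf x1 cf.
have xu : x < x + 1 by rewrite ltrDl.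
have [h1 h2] := continuous_FTC1_closed xu (exp_bounded_integrable (-1) (x + 1) L0 hf) x1 cf.
by rewrite -h2; exact: derivable_is_derive.
Qed.

(** Dominated convergence, with the exponential weight as majorant on [[-1, y]]; pointwise
    convergence of the Picard iterates is then enough. *)
Lemma prim_cvg L C (f_ : nat -> R -> R) f y : 0 <= L ->
  (forall n, exp_bounded L C (f_ n)) -> exp_bounded L C f ->
  (forall t, f_ n t @[n --> \oo] --> f t) ->
  prim (f_ n) y @[n --> \oo] --> prim f y.
Proof.
move=> L0 hf_ hf cf.
have he := exp_weight_bounded L (exp_bounded_ge0 hf).
have mD : measurable (`[-1, y]%classic : set R) by exact: measurable_itv.
have h1 n : measurable_fun `[-1, y] (EFin \o f_ n).
  by apply/measurable_EFinP/measurable_funTS; have [] := hf_ n.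
have h2 : measurable_fun `[-1, y] (EFin \o f).
  by apply/measurable_EFinP/measurable_funTS; have [] := hf.
have h3 : {ae mu, forall t, `[-1, y]%classic t ->
    (EFin \o f_ n) t @[n --> \oo] --> (EFin \o f) t}.
  by apply: aeW => t _; apply: cvg_EFin; [exact: nearW|exact: cf].
have h4 := exp_bounded_integrable (-1) y L0 he.
have h5 : {ae mu, forall t n, `[-1, y]%classic t ->
    (`|(EFin \o f_ n) t| <= (EFin \o (fun t => C * expR (L * t))%R) t)%E}.
  by apply: aeW => t n _; rewrite /= lee_fin; have [_] := hf_ n.
have [_ _ h] := @dominated_convergence _ _ R mu _ mD _ _ _ h1 h2 h3 h4 h5.
rewrite /prim /Rintegral; apply: fine_cvg; rewrite fineK //.
by apply: integrable_fin_num => //; exact: (exp_bounded_integrable _ _ L0 hf).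
Qed.

End primitive.

(** * Picard iteration for [phi'' = q phi] *)

Section second_order_ode.
Context {R : realType}.
Variables (q : R -> R) (M : R).
Hypothesis mq : measurable_fun setT q.
Hypothesis bq : forall t, `|q t| <= M.

Let M0 : 0 <= M. Proof. exact: le_trans (bq 0). Qed.

(** The operator [T] below has norm at most [M / L^2], which this choice keeps below 1/2; the
    summand 2 keeps [L] positive when [M = 0]. *)
Let L := 2 * M + 2.
Let L0 : 0 < L. Proof. by rewrite /L; move: M0; lra. Qed.
Let L0' : 0 <= L. Proof. exact: ltW. Qed.

(** The initial slope 1, cut off to the left of -1: the constant 1 is not bounded by [C exp (L t)]
    as [t] tends to minus infinity. Since [prim] integrates over [[-1, y]] only, its values do not
    change. *)
Let one : R -> R := \1_(`[-1, +oo[).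

Let one_bounded : exp_bounded L (expR L) one.
Proof.
split; first exact: measurable_indic.
move=> t; rewrite /one indicE; case: (boolP (t \in _)) => [|_] /=.
  rewrite inE /= in_itv /= andbT => t1; rewrite normr1 -expRD -expR0 ler_expR.
  by rewrite -[X in X + _]mulr1 -mulrDr mulr_ge0 // -lerBlDl sub0r.
by rewrite normr0 mulr_ge0 // expR_ge0.
Qed.

(** With [phi (-1) = 0] and slope 1 at -1, the equation becomes the fixed point problem
    [phi = prim one + T phi], solved by the Neumann series with terms [d n]. *)
Let T f := prim (prim (fun t => q t * f t)).

Let T_bounded C f : exp_bounded L C f -> exp_bounded L (C / 2) (T f).
Proof.
move=> hf; have C0 := exp_bounded_ge0 hf.
apply: exp_boundedS (prim_exp_bounded L0 (prim_exp_bounded L0 (exp_boundedM mq bq hf))).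
rewrite -mulrA -invfM mulrAC [leRHS]mulrC ler_wpM2r // ler_pdivrMr ?mulr_gt0 //.
by have h2 := sqr_ge0 M; rewrite expr2 in h2; rewrite /L; move: M0; nra.
Qed.

Let T_D C D f g : exp_bounded L C f -> exp_bounded L D g ->
  T (fun t => f t + g t) = (fun t => T f t + T g t).
Proof.
move=> hf hg; apply/funext => y; rewrite /T.
have hqf := exp_boundedM mq bq hf; have hqg := exp_boundedM mq bq hg.
have -> : (fun t => q t * (f t + g t)) = (fun t => q t * f t + q t * g t).
  by apply/funext => t; rewrite mulrDr.
have -> : prim (fun t => q t * f t + q t * g t) =
    (fun y => prim (fun t => q t * f t) y + prim (fun t => q t * g t) y).
  by apply/funext => t; exact: (primD _ L0' hqf hqg).
exact: (primD _ L0' (prim_exp_bounded L0 hqf) (prim_exp_bounded L0 hqg)).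
Qed.

Let d n := iter n T (prim one).

Let d_bounded n : exp_bounded L (geometric (expR L / L) 2^-1 n) (d n).
Proof.
elim: n => [|n IH]; rewrite /geometric /=.
  by rewrite expr0 mulr1; exact: prim_exp_bounded.
by rewrite exprSr mulrA; exact: T_bounded.
Qed.

Let S n t := \sum_(0 <= i < n) d i t.

Let S0 : S 0 = (fun=> 0).
Proof. by apply/funext => t; rewrite /S big_geq. Qed.

Let SS n : S n.+1 = (fun t => S n t + d n t).
Proof. by apply/funext => t; rewrite /S big_nat_recr. Qed.

Let half_norm : `|2^-1 : R| < 1.
Proof. by rewrite ger0_norm ?invr_ge0 // invf_lt1 // ltr1n. Qed.

Let B := expR L / L * (1 - 2^-1)^-1.

Let S_bounded n : exp_bounded L B (S n).
Proof.
apply: (@exp_boundedS _ _ (series (geometric (expR L / L) 2^-1) n)).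
  by apply: geometric_le_lim; rewrite ?half_norm ?invr_gt0 ?divr_ge0 ?expR_ge0.
elim: n => [|n IH].
  rewrite S0 /series /= big_geq //; split; first exact: measurable_cst.
  by move=> t; rewrite normr0 mul0r.
rewrite SS /series /= big_nat_recr //=.
exact: exp_boundedD (d_bounded n).
Qed.

Let S_rec n : S n.+1 = (fun t => prim one t + T (S n) t).
Proof.
elim: n => [|n IH].
  apply/funext => t; rewrite SS S0 add0r /d /= -[LHS]addr0; congr (_ + _).
  have p0 : prim (fun=> 0 : R) = (fun=> 0 : R).
    by apply/funext => u; rewrite /prim /Rintegral integral0.
  by rewrite /T; under [X in prim (prim X)]eq_fun do rewrite mulr0; rewrite p0 p0.
rewrite [LHS]SS {1}IH [in RHS]SS (T_D (S_bounded n) (d_bounded n)).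
by apply/funext => t; rewrite -addrA.
Qed.

Let S_cvg t : cvgn (fun n => S n t).
Proof.
rewrite (_ : (fun n => S n t) = series (fun i => d i t)) //.
apply: normed_cvg.
apply: (@series_le_cvg _ _ (geometric (expR L / L * expR (L * t)) 2^-1)).
- by move=> n; exact: normr_ge0.
- move=> n; apply: geometric_ge0; last by rewrite invr_ge0.
  by rewrite mulr_ge0 ?divr_ge0 ?expR_ge0.
- move=> n; have [_ /(_ t)] := d_bounded n.
  by rewrite /geometric /= mulrAC.
- exact: is_cvg_geometric_series.
Qed.

Let phi (t : R) : R := limn (fun n => S n t).

Let phi_bounded : exp_bounded L B phi.
Proof.
split.
  apply: (@measurable_fun_cvg _ _ _ _ S) => [n|x _].
    by have [] := S_bounded n.
  exact: S_cvg.
move=> t; rewrite ler_norml; apply/andP; split.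
  apply: limr_ge; first exact: S_cvg.
  by apply: nearW => n; have [_ /(_ t)] := S_bounded n; rewrite ler_norml => /andP[].
apply: limr_le; first exact: S_cvg.
by apply: nearW => n; have [_ /(_ t)] := S_bounded n; rewrite ler_norml => /andP[].
Qed.

(** The recursion for the partial sums passes to the limit under both integrals by dominated
    convergence; the majorant is uniform because the geometric series bounds every [S n] by [B]. *)
Let phi_fix : phi = (fun t => prim one t + T phi t).
Proof.
apply/funext => t; apply: cvg_lim => //.
rewrite -(cvg_shiftS (fun n => S n t)) /=.
under eq_fun do rewrite S_rec.
apply: cvgD; first exact: cvg_cst.
have hS n := exp_boundedM mq bq (S_bounded n).
have hphi := exp_boundedM mq bq phi_bounded.
rewrite /T; apply: (prim_cvg (C := M * B / L) L0').
- by move=> n; exact: prim_exp_bounded.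
- exact: prim_exp_bounded.
- move=> u; apply: (prim_cvg L0' hS hphi) => v.
  apply: cvgM; [exact: cvg_cst|exact: S_cvg].
Qed.

(** Derivatives are available only on the open interval, where [q] is continuous; [phi] and [p] are
    built from primitives, hence continuous everywhere, and this gives the data at -1 their
    meaning. *)
Lemma ode_solution : (forall t : R, -1 < t < 1 -> {for t, continuous q}) ->
  exists phi p : R -> R, [/\ continuous phi, continuous p,
    phi (-1) = 0 /\ p (-1) = 1,
    forall t : R, -1 < t < 1 -> is_derive t (1 : R) phi (p t)
    & forall t : R, -1 < t < 1 -> is_derive t (1 : R) p (q t * phi t)].
Proof.
move=> cq; pose p t := 1 + prim (fun t => q t * phi t) t.
have hphi := exp_boundedM mq bq phi_bounded.
have cphi : continuous phi.
  rewrite phi_fix => t; apply: cvgD; first exact: prim_continuous one_bounded _.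
  exact: prim_continuous (prim_exp_bounded L0 hphi) _.
have cp : continuous p.
  move=> t; apply: cvgD; first exact: cvg_cst.
  exact: prim_continuous hphi _.
exists phi, p; split=> //.
- by rewrite phi_fix /p /T !prim_init !addr0.
- move=> t /andP[t1 t2]; rewrite [X in is_derive _ _ X _]phi_fix.
  have one1 : one t = 1 by rewrite /one indicE mem_set //= in_itv /= ltW.
  have -> : p t = one t + prim (fun t => q t * phi t) t by rewrite one1.
  apply: is_derive1_add.
    apply: (is_derive_prim L0' one_bounded t1).
    have ht : \forall x \near t, -1 < x := lt_nbhsr t1.
    have h1 : \forall x \near t, one x = 1.
      by apply: filterS ht => x /= x1; rewrite /one indicE mem_set //= in_itv /= ltW.
    by rewrite /prop_for /continuous_at one1; exact: cvg_near_cst h1.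
  apply: (is_derive_prim L0' (prim_exp_bounded L0 hphi) t1).
  exact: prim_continuous hphi _.
- move=> t /andP[t1 t2]; rewrite -[_ * _]add0r; apply: is_derive1_add.
  apply: (is_derive_prim L0' hphi t1).
  by apply: continuousM; [apply: cq; rewrite t1|exact: cphi].
Qed.

End second_order_ode.

(** * Shooting *)

Section calculus_facts.
Context {R : realType}.
Implicit Types (f g df : R -> R) (a b x y : R).

Lemma continuous_for_cst (c : R) x : {for x, continuous (fun=> c : R)}.
Proof. exact: cvg_cst. Qed.

Lemma continuous_for_add f g x : {for x, continuous f} -> {for x, continuous g} ->
  {for x, continuous (fun t => f t + g t)}.
Proof. exact: cvgD. Qed.

Lemma continuous_for_sub f g x : {for x, continuous f} -> {for x, continuous g} ->
  {for x, continuous (fun t => f t - g t)}.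
Proof. exact: cvgB. Qed.

Lemma continuous_for_mul f g x : {for x, continuous f} -> {for x, continuous g} ->
  {for x, continuous (fun t => f t * g t)}.
Proof. exact: cvgM. Qed.

Lemma MVT_continuous f df a b : a < b ->
  (forall x, a < x < b -> is_derive x (1 : R) f (df x)) ->
  (forall x, a <= x <= b -> {for x, continuous f}) ->
  exists2 c, a < c < b & f b - f a = df c * (b - a).
Proof.
move=> ab dF cf.
have h1 x : x \in `]a, b[ -> is_derive x (1 : R) f (df x) by rewrite in_itv; exact: dF.
have h2 : {within `[a, b], continuous f}.
  by apply: continuous_in_subspaceT => x /[!inE] /=; rewrite in_itv; exact: cf.
by have [c] := MVT ab h1 h2; rewrite in_itv; exists c.
Qed.

Lemma le_of_derive_ge0 f df a b : a <= b ->
  (forall x, a < x < b -> is_derive x (1 : R) f (df x)) ->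
  (forall x, a <= x <= b -> {for x, continuous f}) ->
  (forall x, a < x < b -> 0 <= df x) -> f a <= f b.
Proof.
rewrite le_eqVlt => /predU1P[-> //|ab] dF cf df0.
have [c cab E] := MVT_continuous ab dF cf.
by rewrite -subr_ge0 E mulr_ge0 ?df0 // subr_ge0 ltW.
Qed.

Lemma ge_of_derive_le0 f df a b : a <= b ->
  (forall x, a < x < b -> is_derive x (1 : R) f (df x)) ->
  (forall x, a <= x <= b -> {for x, continuous f}) ->
  (forall x, a < x < b -> df x <= 0) -> f b <= f a.
Proof.
rewrite le_eqVlt => /predU1P[-> //|ab] dF cf df0.
have [c cab E] := MVT_continuous ab dF cf.
rewrite -subr_le0 E mulr_le0_ge0 ?df0 // subr_ge0 ltW //.
Qed.

Lemma continuous_bounded_itv f a b : a <= b ->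
  (forall x, a <= x <= b -> {for x, continuous f}) ->
  exists2 B, 0 <= B & forall x, a <= x <= b -> `|f x| <= B.
Proof.
move=> ab cf.
have cw : {within `[a, b], continuous f}.
  by apply: continuous_in_subspaceT => x /[!inE] /=; rewrite in_itv; exact: cf.
have [c _ hc] := EVT_max ab cw; have [d _ hd] := EVT_min ab cw.
exists (`|f c| + `|f d|) => [|x xab]; first by rewrite addr_ge0.
have xI : x \in `[a, b] by rewrite in_itv.
have := hc x xI; have := hd x xI; rewrite ler_norml.
have := ler_norm (f c); have := ler_norm (- f d); rewrite normrN.
by have := normr_ge0 (f c); have := normr_ge0 (f d); lra.
Qed.

Lemma continuous_for_ball f x e : {for x, continuous f} -> 0 < e ->
  exists2 d, 0 < d & forall y, `|y - x| <= d -> `|f y - f x| <= e.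
Proof.
move=> cf e0; have /cvgrPdist_le /(_ e e0) := cf.
rewrite -nbhs_nearE => /nbhs_ballP[d /= d0 hd]; exists (d / 2).
  by rewrite divr_gt0.
move=> y yx; have : ball x d y.
  rewrite /ball /= distrC; apply: le_lt_trans yx _.
  by rewrite ltr_pdivrMr // ltr_pMr // ltr1n.
by move=> /hd /=; rewrite distrC.
Qed.

(** [F exp (- C x)] is nonincreasing and [F exp (C x)] nondecreasing. The forward bound serves
    dependence on the parameter, the backward bound nonvanishing. *)
Lemma gronwall (F dF : R -> R) (C s t : R) : (forall x, s <= x <= t -> {for x, continuous F}) ->
  (forall x, s < x < t -> is_derive x (1 : R) F (dF x)) ->
  (forall x, s < x < t -> `|dF x| <= C * F x) -> s <= t ->
  F t <= F s * expR (C * (t - s)) /\ F s <= F t * expR (C * (t - s)).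
Proof.
move=> cF dFF hF st.
have dE K x : is_derive x (1 : R) (fun y => expR (K * y)) (K * expR (K * x)).
  have := is_derive_exp_weight K 1 x.
  by under eq_fun do rewrite mul1r; rewrite mulr1.
have dG K x : s < x < t -> is_derive x (1 : R) (fun y => F y * expR (K * y))
    ((dF x + K * F x) * expR (K * x)).
  move=> xst; apply: (is_derive_eq (is_derive1_mul (dFF x xst) (dE K x))).
  by rewrite mulrDl; congr (_ + _); rewrite mulrCA mulrA.
have cG K x : s <= x <= t -> {for x, continuous (fun y => F y * expR (K * y))}.
  move=> xst; apply: continuous_for_mul; first exact: cF.
  exact: is_derive1_continuous (dE K x).
have e0 x := expR_gt0 (C * x).
have h1 : F t * expR (- C * t) <= F s * expR (- C * s).
  apply: (ge_of_derive_le0 st (dG (- C)) (cG (- C))) => x xst.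
  rewrite mulr_le0_ge0 ?expR_ge0 //.
  by have := hF x xst; rewrite ler_norml; lra.
have h2 : F s * expR (C * s) <= F t * expR (C * t).
  apply: (le_of_derive_ge0 st (dG C) (cG C)) => x xst.
  rewrite mulr_ge0 ?expR_ge0 //.
  by have := hF x xst; rewrite ler_norml; lra.
split.
  move: h1; rewrite -(ler_pM2r (e0 t)) -!mulrA -!expRD.
  by rewrite mulNr addNr expR0 mulr1 mulrBr addrC mulNr.
move: h2; rewrite -(ler_pM2r (expR_gt0 (- (C * s)))) -!mulrA -!expRD.
by rewrite subrr expR0 mulr1 -mulrBr.
Qed.

End calculus_facts.

(** * Shots: existence, energy estimates, dependence on the parameter *)

Section shooting.
Context {R : realType}.
Variables (a : R -> R) (A : R).
Hypothesis ca : forall t : R, -1 < t < 1 -> {for t, continuous a}.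
Hypothesis ba : forall t : R, -1 < t < 1 -> `|a t| <= A.
Implicit Types (k m t : R) (phi p : R -> R).

(* [k] stands for the square of the wave number and [m] for [1 / lambda]. *)
Definition shot k m phi p := [/\ continuous phi, continuous p,
  phi (-1) = 0 /\ p (-1) = 1,
  forall t : R, -1 < t < 1 -> is_derive t (1 : R) phi (p t)
  & forall t : R, -1 < t < 1 ->
      is_derive t (1 : R) p (k * (1 - m * a t) * phi t)].

(** Including the endpoint 1 makes positivity an open condition in [m], and lets it fail at the
    critical parameter through a zero at 1. *)
Definition positive_shot phi := forall t : R, -1 < t <= 1 -> 0 < phi t.

Let A0 : 0 <= A. Proof. by apply: le_trans (ba (t := 0) _); rewrite // ltrN10 ltr01. Qed.

Lemma shot_exists k m : exists phi p, shot k m phi p.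
Proof.
(* Nothing is known about [a] outside the open interval; cutting the coefficient to zero there makes
   it globally bounded and measurable. *)
pose q := (fun t : R => k * (1 - m * a t)) \_ `]-1, 1[.
have qE t : -1 < t < 1 -> q t = k * (1 - m * a t).
  by move=> tI; rewrite /q patchE mem_set //= in_itv.
have cqa t : -1 < t < 1 -> {for t, continuous (fun t : R => k * (1 - m * a t))}.
  move=> tI; apply: continuous_for_mul; first exact: continuous_for_cst.
  apply: continuous_for_sub; first exact: continuous_for_cst.
  by apply: continuous_for_mul; [exact: continuous_for_cst|exact: ca].
have cq t : -1 < t < 1 -> {for t, continuous q}.
  move=> tI; rewrite /prop_for /continuous_at qE //; apply: cvg_trans (cqa t tI).
  apply: near_eq_cvg.
  have h : \forall x \near t, x \in `]-1, 1[ by exact: near_in_itvoo.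
  by apply: filterS h => x; rewrite in_itv => xI; rewrite qE.
have mq : measurable_fun setT q.
  have h : {in `]-1, 1[%classic, continuous (fun t : R => k * (1 - m * a t))}.
    by move=> t; rewrite inE /= in_itv /=; exact: cqa.
  apply/(measurable_restrictT _ (measurable_itv _)).
  exact: (open_continuous_measurable_fun (itv_open _ _) h).
have bq t : `|q t| <= `|k| * (1 + `|m| * A).
  rewrite /q patchE; case: ifPn => [|_].
    rewrite inE /= in_itv /= => tI; rewrite normrM ler_wpM2l //.
    rewrite (le_trans (ler_normB _ _)) // normr1 lerD2l normrM ler_wpM2l //.
    exact: ba.
  by rewrite normr0 mulr_ge0 // addr_ge0 // mulr_ge0.
have [phi [p [h1 h2 h3 h4 h5]]] := ode_solution mq bq cq.
exists phi, p; split=> // t tI; rewrite -qE //; exact: h5.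
Qed.

Let q_bound k m t : 0 <= k -> -1 < t < 1 ->
  `|k * (1 - m * a t)| <= k * (1 + `|m| * A).
Proof.
move=> k0 tI; rewrite normrM (ger0_norm k0) ler_wpM2l //.
rewrite (le_trans (ler_normB _ _)) // normr1 lerD2l normrM ler_wpM2l //.
exact: ba.
Qed.

(** The constant [e ^+ 2] in the energy absorbs the forcing term, so that the inhomogeneous bound on
    [w] still falls under the homogeneous Gronwall inequality. *)
Lemma energy_gronwall (u p w : R -> R) (K e : R) s t : 0 <= K -> 0 <= e ->
  continuous u -> continuous p ->
  (forall x : R, -1 < x < 1 -> is_derive x (1 : R) u (p x)) ->
  (forall x : R, -1 < x < 1 -> is_derive x (1 : R) p (w x)) ->
  (forall x : R, -1 < x < 1 -> `|w x| <= K * `|u x| + e) ->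
  -1 <= s -> s <= t -> t <= 1 ->
  let E x := u x ^+ 2 + p x ^+ 2 + e ^+ 2 in
  E t <= E s * expR ((K + 2) * (t - s)) /\ E s <= E t * expR ((K + 2) * (t - s)).
Proof.
move=> K0 e0 cu cp du dp hw s1 st t1 E.
apply: (@gronwall _ E (fun x => 2 * u x * p x + 2 * p x * w x)) => //.
- move=> x _.
  have -> : E = (fun x => u x * u x + p x * p x + e ^+ 2) by [].
  apply: continuous_for_add; last exact: continuous_for_cst.
  by apply: continuous_for_add; apply: continuous_for_mul;
    [exact: cu|exact: cu|exact: cp|exact: cp].
- move=> x /andP[sx xt].
  have xI : -1 < x < 1 by rewrite (le_lt_trans s1 sx) (lt_le_trans xt t1).
  have := is_derive1_add (is_derive1_add (is_derive1_exprn 2 (du x xI))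
    (is_derive1_exprn 2 (dp x xI))) (is_derive_cst (e ^+ 2) x (1 : R)).
  by rewrite addr0 /= !expr1.
- move=> x /andP[sx xt].
  have xI : -1 < x < 1 by rewrite (le_lt_trans s1 sx) (lt_le_trans xt t1).
  rewrite /E; have := hw x xI.
  set U := u x; set P := p x; set W := w x => hW.
  have h1 : `|2 * U * P + 2 * P * W| <= 2 * `|U| * `|P| + 2 * `|P| * (K * `|U| + e).
    rewrite (le_trans (ler_normD _ _)) // !normrM ger0_norm // lerD //.
    by rewrite ler_wpM2l // mulr_ge0.
  apply: le_trans h1 _.
  rewrite -(real_normK (num_real U)) -(real_normK (num_real P)).
  have := normr_ge0 U; have := normr_ge0 P; move: `|U| `|P| => X Y Y0 X0.
  (* The origin of [K + 2]: [2 (K + 1) X Y <= (K + 1) (X^2 + Y^2)] and [2 Y e <= Y^2 + e^2]. *)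
  have h2 : 0 <= (K + 1) * (X - Y) ^+ 2 by rewrite mulr_ge0 ?sqr_ge0 // addr_ge0.
  have h3 : 0 <= (Y - e) ^+ 2 by exact: sqr_ge0.
  have h4 : 0 <= X ^+ 2 by exact: sqr_ge0.
  have h5 : 0 <= (K + 1) * e ^+ 2 by rewrite mulr_ge0 ?sqr_ge0 // addr_ge0.
  by nra.
Qed.

(** The energy is 1 at -1, and the backward Gronwall bound prevents it from having dropped to 0 at
    [t]. *)
Lemma shot_energy_gt0 k m phi p t : 0 <= k -> shot k m phi p -> -1 <= t <= 1 ->
  0 < phi t ^+ 2 + p t ^+ 2.
Proof.
move=> k0 [c1 c2 [i1 i2] d1 d2] /andP[t1 t2].
have K0 : 0 <= k * (1 + `|m| * A) by rewrite mulr_ge0 // addr_ge0 // mulr_ge0.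
have hw x : -1 < x < 1 -> `|k * (1 - m * a x) * phi x| <=
    k * (1 + `|m| * A) * `|phi x| + 0.
  by move=> xI; rewrite addr0 normrM ler_wpM2r // q_bound.
have [_] := energy_gronwall K0 (lexx 0) c1 c2 d1 d2 hw (lexx (-1)) t1 t2.
rewrite i1 i2 expr0n /= !addr0 add0r expr1n => h.
rewrite ltNge; apply/negP => hle; have := lt_le_trans (ltr01) h.
rewrite ltNge => /negP; apply; rewrite mulr_le0_ge0 // expR_ge0 //.
Qed.

(** The difference of two shots has zero initial data and solves the equation for [m'] with the
    additional term [k (m' - m) a phi], a forcing proportional to [|m' - m|]. *)
Lemma shot_lipschitz k m phi p : 0 <= k -> shot k m phi p ->
  exists2 C, 0 <= C & forall m' phi' p', `|m' - m| <= 1 -> shot k m' phi' p' ->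
    forall t : R, -1 <= t <= 1 -> `|phi' t - phi t| <= C * `|m' - m| /\
      `|p' t - p t| <= C * `|m' - m|.
Proof.
move=> k0 [c1 c2 [i1 i2] d1 d2].
have N11 : -1 <= 1 :> R by rewrite (le_trans (lerN10 R) ler01).
have [B B0 hB] := continuous_bounded_itv N11 (fun x _ => c1 x).
(* [|m| + 1] bounds all admissible [|m'|], so the constant is uniform in [m']. *)
pose K := k * (1 + (`|m| + 1) * A).
have K0 : 0 <= K by rewrite mulr_ge0 // addr_ge0 // mulr_ge0 // addr_ge0.
exists (k * A * B * expR (K + 2)); first by rewrite !mulr_ge0 // expR_ge0.
move=> m' phi' p' hm [c1' c2' [i1' i2'] d1' d2'] t /andP[t1 t2].
have e0 : 0 <= k * A * B * `|m' - m| by rewrite !mulr_ge0.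
have hw x : -1 < x < 1 ->
    `|k * (1 - m' * a x) * phi' x - k * (1 - m * a x) * phi x| <=
    K * `|phi' x - phi x| + k * A * B * `|m' - m|.
  move=> xI.
  have -> : k * (1 - m' * a x) * phi' x - k * (1 - m * a x) * phi x =
    k * (1 - m' * a x) * (phi' x - phi x) - k * (m' - m) * a x * phi x by ring.
  rewrite (le_trans (ler_normB _ _)) // lerD //.
    rewrite normrM ler_wpM2r // (le_trans (q_bound _ k0 xI)) // ler_wpM2l //.
    rewrite lerD2l ler_wpM2r // -[m'](subrK m) (le_trans (ler_normD _ _)) //.
    by rewrite addrC lerD2l.
  rewrite !normrM (ger0_norm k0) -!mulrA ler_wpM2l //.
  rewrite [leRHS]mulrA [leRHS]mulrC ler_wpM2l // ler_pM //; first exact: ba.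
  by apply: hB; case/andP: xI => /ltW -> /ltW ->.
have cu : continuous (fun x => phi' x - phi x).
  by move=> x; apply: cvgB; [exact: c1'|exact: c1].
have cp : continuous (fun x => p' x - p x).
  by move=> x; apply: cvgB; [exact: c2'|exact: c2].
have du (x : R) : -1 < x < 1 -> is_derive x (1 : R) (fun x => phi' x - phi x) (p' x - p x).
  by move=> xI; exact: is_derive1_sub (d1' x xI) (d1 x xI).
have dp (x : R) : -1 < x < 1 -> is_derive x (1 : R) (fun x => p' x - p x)
    (k * (1 - m' * a x) * phi' x - k * (1 - m * a x) * phi x).
  by move=> xI; exact: is_derive1_sub (d2' x xI) (d2 x xI).
have [h _] := energy_gronwall K0 e0 cu cp du dp hw (lexx (-1)) t1 t2.
move: h; rewrite i1 i2 i1' i2' !subrr expr0n /= !add0r.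
set e := k * A * B * _ => h.
(* Since [t + 1 <= 2], the growth factor is at most a perfect square, and taking square roots gives
   the linear bound. *)
have hE : expR ((K + 2) * (t - -1)) <= expR (K + 2) ^+ 2.
  rewrite -expRM_natr ler_expR ler_wpM2l ?addr_ge0 //; lra.
have h' : (phi' t - phi t) ^+ 2 + (p' t - p t) ^+ 2 <= (e * expR (K + 2)) ^+ 2.
  rewrite exprMn; apply: (le_trans (y := e ^+ 2 * expR ((K + 2) * (t - -1)))).
    by apply: le_trans h; rewrite lerDl sqr_ge0.
  by rewrite ler_wpM2l // sqr_ge0.
have -> : k * A * B * expR (K + 2) * `|m' - m| = e * expR (K + 2).
  by rewrite /e mulrAC.
have E0 : 0 <= e * expR (K + 2) by rewrite mulr_ge0 // expR_ge0.
have sq x : x ^+ 2 <= (e * expR (K + 2)) ^+ 2 -> `|x| <= e * expR (K + 2).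
  by move=> hx; rewrite -ler_sqr ?nnegrE // real_normK // num_real.
split; apply: sq; apply: le_trans h'; rewrite ?lerDl ?lerDr ?sqr_ge0 //.
Qed.

End shooting.

(** * Positivity of shots: stability, convexity, oscillation *)

Section shooting_comparison.
Context {R : realType}.
Variables (a : R -> R) (A : R).
Hypothesis ba : forall t : R, -1 < t < 1 -> `|a t| <= A.
Implicit Types (k m t : R) (phi p : R -> R).

(** Near -1 every shot is small, so closeness of values cannot give positivity; closeness of slopes
    does. The slope [p] is within 1/4 of 1 on the interval and [p'] within 1/4 of [p], hence [p'] is
    at least 1/2. The length [d] depends only on the reference shot. *)
Lemma shot_near_left k m phi p : shot a k m phi p ->
  exists2 d : R, 0 < d <= 1 & forall phi' p' m', shot a k m' phi' p' ->
    (forall t : R, -1 <= t <= -1 + d -> `|p' t - p t| <= 4^-1) ->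
    forall t : R, -1 <= t <= -1 + d -> (t + 1) / 2 <= phi' t.
Proof.
move=> [_ c2 [_ i2] _ _].
have h4 : 0 < 4^-1 :> R by rewrite invr_gt0.
have [d d0 hd] := continuous_for_ball (c2 (-1)) h4.
exists (Num.min d 1); first by rewrite lt_min d0 ltr01 ge_min lexx orbT.
move=> phi' p' m' [c1' _ [i1' i2'] d1' _] hp t /andP[t1 td].
have td' : t <= -1 + d by apply: le_trans td _; rewrite lerD2l ge_min lexx.
have td1 : t <= 0 by apply: le_trans td _; rewrite -lerBrDl sub0r opprK ge_min lexx orbT.
have h : phi' (-1) - 2^-1 * (-1) <= phi' t - 2^-1 * t.
  apply: (@le_of_derive_ge0 _ (fun x => phi' x - 2^-1 * x) (fun x => p' x - 2^-1)) => //.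
  - move=> x /andP[x1 xt]; apply: is_derive1_sub.
      by apply: d1'; rewrite x1 /=; lra.
    have := is_derive1_affine 2^-1 0 x.
    by under eq_fun do rewrite addr0.
  - move=> x _; apply: continuous_for_sub; first exact: c1'.
    by apply: continuous_for_mul; [exact: continuous_for_cst|exact: cvg_id].
  - move=> x /andP[x1 xt].
    have := hp x; rewrite (ltW x1) (le_trans (ltW xt) td) => /(_ isT).
    have hx : `|x - -1| <= d by rewrite ger0_norm; lra.
    have := hd x hx; rewrite i2 !ler_norml; lra.
by move: h; rewrite i1'; lra.
Qed.

(** Near -1 the slopes give positivity; on the remaining compact interval [phi] has a positive
    minimum, which a small uniform perturbation cannot cancel. *)
Lemma shot_stable k m phi p : 0 <= k -> shot a k m phi p -> positive_shot phi ->
  exists2 e : R, 0 < e & forall m' phi' p', `|m' - m| <= e ->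
    shot a k m' phi' p' -> positive_shot phi'.
Proof.
move=> k0 hs hpos.
have [C C0 hC] := shot_lipschitz ba k0 hs.
have [d /andP[d0 d1] hd] := shot_near_left hs.
have [c1 _ _ _ _] := hs.
have le1 : -1 + d <= 1 by lra.
have cw : {within `[-1 + d, 1], continuous phi} by exact: continuous_subspaceT.
have [c] := EVT_min le1 cw; rewrite in_itv /= => /andP[ca1 cb1] hmin.
have m0 : 0 < phi c by apply: hpos; rewrite cb1 andbT; lra.
(* The bound 1 is the range of the Lipschitz estimate, 1/4 the slope tolerance near -1, and
   [phi c / 2] half the minimum on the rest. *)
pose e := Num.min 1 (Num.min 4^-1 (phi c / 2) / (C + 1)).
have C1 : 0 < C + 1 by rewrite ltr_wpDl.
have e0 : 0 < e.
  by rewrite lt_min ltr01 divr_gt0 // lt_min invr_gt0 ltr0n divr_gt0.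
exists e => // m' phi' p' hm hs' t /andP[t1 t2].
have hm1 : `|m' - m| <= 1 by apply: le_trans hm _; rewrite ge_min lexx.
have hCm : C * `|m' - m| <= Num.min 4^-1 (phi c / 2).
  apply: (@le_trans _ _ ((C + 1) * `|m' - m|)); first by rewrite ler_wpM2r // lerDl.
  rewrite mulrC -ler_pdivlMr //; apply: le_trans hm _.
  by rewrite ge_min lexx orbT.
move: hCm; rewrite le_min => /andP[hCm1 hCm2].
have [td|td] := leP t (-1 + d).
  have hp x : -1 <= x <= -1 + d -> `|p' x - p x| <= 4^-1.
    move=> /andP[x1 x2]; apply: le_trans hCm1.
    have xI : -1 <= x <= 1 by rewrite x1 /=; lra.
    by have [] := hC _ _ _ hm1 hs' x xI.
  have tI : -1 <= t <= -1 + d by rewrite (ltW t1).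
  by have := hd _ _ _ hs' hp t tI; lra.
have : `|phi' t - phi t| <= phi c / 2.
  have tI : -1 <= t <= 1 by rewrite (ltW t1).
  by apply: le_trans hCm2; have [] := hC _ _ _ hm1 hs' t tI.
have : phi c <= phi t by apply: hmin; rewrite in_itv /= (ltW td).
by rewrite ler_norml; lra.
Qed.

(** An interior zero of a nonnegative shot is a minimum, so the slope vanishes there too, against
    the positivity of the energy. *)
Lemma shot_no_interior_zero k m phi p t : 0 <= k -> shot a k m phi p -> -1 < t < 1 ->
  phi t = 0 -> (forall s : R, -1 < s < 1 -> 0 <= phi s) -> False.
Proof.
move=> k0 hs tI phit hpos.
have tc : -1 <= t <= 1 by case/andP: tI => /ltW -> /ltW ->.
have := shot_energy_gt0 ba k0 hs tc.
have [_ _ _ d1 _] := hs.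
have D : is_derive t (1 : R) phi 0.
  apply: (@derive1_at_min _ phi (-1) 1).
  - by rewrite (le_trans (lerN10 R) ler01).
  - by move=> x; rewrite in_itv /= => xI; have [] := d1 x xI.
  - by rewrite in_itv.
  - by move=> x; rewrite in_itv /= phit; exact: hpos.
have -> : p t = 0.
  by rewrite -(is_derive1_derive1 (d1 t tI)); exact: is_derive1_derive1 D.
by rewrite phit expr0n /= addr0 ltxx.
Qed.

(** For [m S <= 1] the coefficient is nonnegative, so [(phi p)' = p^2 + k (1 - m a) phi^2 >= 0]
    whatever the sign of [phi]. Thus [phi^2] is nondecreasing, and [phi], positive just after -1,
    cannot return to 0. *)
Lemma shot_le_sup_positive k m S phi p : 0 <= k -> 0 <= m -> m * S <= 1 ->
  (forall t : R, -1 < t < 1 -> a t <= S) ->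
  shot a k m phi p -> positive_shot phi.
Proof.
move=> k0 m0 mS haS hs t /andP[t1 t2].
have [c1 c2 [i1 i2] d1 d2] := hs.
have [d /andP[d0 dle1] hd] := shot_near_left hs.
have near s : -1 < s <= -1 + d -> 0 < phi s.
  move=> /andP[s1 s2].
  have hp x : -1 <= x <= -1 + d -> `|p x - p x| <= 4^-1.
    by rewrite subrr normr0 invr_ge0.
  have sI : -1 <= s <= -1 + d by rewrite (ltW s1).
  by have := hd _ _ _ hs hp s sI; lra.
have php s : -1 <= s <= 1 -> 0 <= phi s * p s.
  move=> /andP[s1 s2].
  have -> : 0 = phi (-1) * p (-1) by rewrite i1 mul0r.
  apply: (@le_of_derive_ge0 _ (fun x => phi x * p x)
    (fun x => p x * p x + phi x * (k * (1 - m * a x) * phi x))) => //.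
  - move=> x /andP[x1 x2].
    have xI : -1 < x < 1 by rewrite x1 (lt_le_trans x2).
    exact: is_derive1_mul (d1 x xI) (d2 x xI).
  - by move=> x _; apply: continuous_for_mul; [exact: c1|exact: c2].
  - move=> x /andP[x1 x2].
    have xI : -1 < x < 1 by rewrite x1 (lt_le_trans x2).
    have hq : 0 <= k * (1 - m * a x).
      rewrite mulr_ge0 // subr_ge0; apply: le_trans mS.
      by rewrite ler_wpM2l // haS.
    rewrite addr_ge0 // -?expr2 ?sqr_ge0 // mulrCA mulr_ge0 //.
    by rewrite -expr2 sqr_ge0.
have [td|td] := leP t (-1 + d); first by apply: near; rewrite t1.
have nd : 0 < phi (-1 + d) by apply: near; lra.
have mono s : -1 + d <= s <= 1 -> phi (-1 + d) ^+ 2 <= phi s ^+ 2.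
  move=> /andP[s1 s2].
  apply: (@le_of_derive_ge0 _ (fun x => phi x ^+ 2)
    (fun x => 2 * phi x ^+ 1 * p x)) => //.
  - move=> x /andP[x1 x2].
    by apply: is_derive1_exprn; apply: d1; lra.
  - by move=> x _; apply: continuous_for_mul; exact: c1.
  - move=> x /andP[x1 x2]; rewrite expr1 -mulrA mulr_ge0 //; apply: php; lra.
rewrite ltNge; apply/negP => phit.
have [c] : exists2 c, c \in `[-1 + d, t] & phi c = 0.
  apply: IVT; first exact: ltW.
    exact: continuous_subspaceT.
  by rewrite ge_min phit orbT le_max (ltW nd).
rewrite in_itv /= => /andP[cd ct] phic.
have := mono c; rewrite cd (le_trans ct t2) phic => /(_ isT).
by rewrite expr0n /= leNgt exprn_gt0.
Qed.

(** The sine [v] of frequency [w] vanishes at [c] and [d]. If [phi] were positive, the Wronskian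
    [p v - phi v'] would be nonincreasing on [[c, d]]; but it is [- w phi c < 0] at [c] and
    [w phi d > 0] at [d]. *)
Lemma shot_oscillates k m (c d : R) phi p : -1 < c -> c < d -> d < 1 ->
  (forall t, c <= t <= d -> k * (1 - m * a t) <= - (pi / (d - c)) ^+ 2) ->
  shot a k m phi p -> ~ positive_shot phi.
Proof.
move=> c1 cd d1 hq [cphi cp _ dphi dp] hpos.
set w := pi / (d - c) in hq.
have dc : 0 < d - c by rewrite subr_gt0.
have w0 : 0 < w by rewrite divr_gt0 // pi_gt0.
pose v x := sin (w * x + - w * c); pose v' x := w * cos (w * x + - w * c).
have dv x : is_derive x (1 : R) v (v' x).
  apply: (is_derive_eq (is_derive1_comp_rule (is_derive1_affine w (- w * c) x) (is_derive_sin _))).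
  by rewrite mulrC.
have dv' x : is_derive x (1 : R) v' (- w ^+ 2 * v x).
  have := is_derive1_mul (is_derive_cst w x (1 : R))
    (is_derive1_comp_rule (is_derive1_affine w (- w * c) x) (is_derive_cos _)).
  by move=> h; apply: (is_derive_eq h); rewrite /v /cst; ring.
have v0 x : c <= x <= d -> 0 <= v x.
  move=> /andP[x1 x2]; apply: sin_ge0_pi.
  rewrite mulNr -mulrBr mulr_ge0 ?subr_ge0 ?(ltW w0) //=.
  by rewrite /w mulrAC ler_pdivrMr // ler_wpM2l ?pi_ge0 // lerD2r.
have vc : v c = 0 by rewrite /v mulNr subrr sin0.
have v'c : v' c = w by rewrite /v' mulNr subrr cos0 mulr1.
have wdc : w * d + - w * c = pi by rewrite mulNr -mulrBr /w divfK // gt_eqF.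
have vd : v d = 0 by rewrite /v wdc sinpi.
have v'd : v' d = - w by rewrite /v' wdc cospi mulrN1.
have pos x : c <= x <= d -> 0 < phi x.
  by move=> /andP[x1 x2]; apply: hpos; rewrite (lt_le_trans c1 x1) /=; lra.
have : p d * v d - phi d * v' d <= p c * v c - phi c * v' c.
  apply: (@ge_of_derive_le0 _ (fun x => p x * v x - phi x * v' x)
   (fun x => (k * (1 - m * a x) * phi x * v x + p x * v' x) -
     (p x * v' x + phi x * (- w ^+ 2 * v x)))).
  - exact: ltW.
  - move=> x /andP[x1 x2].
    have xI : -1 < x < 1 by rewrite (lt_trans c1 x1) (lt_trans x2 d1).
    apply: is_derive1_sub; apply: is_derive1_mul => //; [exact: dp|exact: dphi].
  - move=> x _; apply: continuous_for_sub; apply: continuous_for_mul.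
    + exact: cp.
    + exact: is_derive1_continuous (dv x).
    + exact: cphi.
    + exact: is_derive1_continuous (dv' x).
  - move=> x /andP[x1 x2].
    have xcd : c <= x <= d by rewrite !ltW.
    have -> : k * (1 - m * a x) * phi x * v x + p x * v' x -
      (p x * v' x + phi x * (- w ^+ 2 * v x)) =
      (k * (1 - m * a x) + w ^+ 2) * (phi x * v x) by ring.
    rewrite mulr_le0_ge0 //; first by rewrite -lerBrDr sub0r hq.
    by rewrite mulr_ge0 ?v0 // ltW ?pos.
rewrite vc vd v'c v'd !mulr0 !sub0r mulrN opprK leNgt => /negP; apply.
have pc : 0 < phi c by apply: pos; rewrite lexx ltW.
have pd : 0 < phi d by apply: pos; rewrite lexx ltW.
by rewrite (@lt_trans _ _ 0) // ?oppr_lt0 mulr_gt0.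
Qed.

End shooting_comparison.

(** * The critical parameter and its dependence on the wave number *)

Section principal_eigenvalue.
Context {R : realType}.
Variables (a : R -> R) (A : R).
Hypothesis ca : forall t : R, -1 < t < 1 -> {for t, continuous a}.
Hypothesis ba : forall t : R, -1 < t < 1 -> `|a t| <= A.
Implicit Types (k m t : R) (phi p : R -> R).

(** Picone's quotient divides by a shot near 1. If [phi 1 > 0], continuity suffices. If [phi 1 = 0],
    the energy gives [p 1 != 0], and positivity on the left of 1 forces [p 1 < 0], so that the zero
    is simple. *)
Lemma shot_near_right k m phi p : 0 <= k -> shot a k m phi p ->
  (forall t : R, -1 < t < 1 -> 0 < phi t) ->
  exists2 d : R, 0 < d <= 1 & exists2 c : R, 0 < c &
    forall t, 1 - d <= t <= 1 -> c * (1 - t) <= phi t.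
Proof.
move=> k0 hs hpos; have [c1 c2 [i1 i2] d1 d2] := hs.
have phi1 : 0 <= phi 1.
  rewrite leNgt; apply/negP => h.
  have e0 : 0 < - phi 1 / 2 by rewrite divr_gt0 // oppr_gt0.
  have [d d0 hd] := continuous_for_ball (c1 1) e0.
  pose t := 1 - Num.min d 1.
  have m0 : 0 < Num.min d 1 by rewrite lt_min d0 ltr01.
  have m1 : Num.min d 1 <= 1 by rewrite ge_min lexx orbT.
  have md : Num.min d 1 <= d by rewrite ge_min lexx.
  have : `|t - 1| <= d by rewrite /t addrAC subrr sub0r normrN gtr0_norm.
  move=> /hd; have : 0 < phi t by apply: hpos; rewrite /t; lra.
  by rewrite ler_norml; lra.
have := phi1; rewrite le_eqVlt => /predU1P[phi10|phi10].
  have p1 : p 1 != 0.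
    apply/negP => /eqP p1.
    have := shot_energy_gt0 ba k0 hs (t := 1).
    rewrite p1 -phi10 expr0n /= addr0 ltxx => h; suff: false by [].
    by apply: h; rewrite lexx (le_trans (lerN10 R) ler01).
  have e0 : 0 < `|p 1| / 2 by rewrite divr_gt0 // normr_gt0.
  have [d d0 hd] := continuous_for_ball (c2 1) e0.
  have main t : -1 < t < 1 -> 1 - t <= d ->
      exists2 x : R, `|p x - p 1| <= `|p 1| / 2 & phi t = - p x * (1 - t).
    move=> /andP[t1 t2] td.
    have dt x : t < x < 1 -> is_derive x (1 : R) phi (p x).
      by move=> /andP[x1 x2]; apply: d1; rewrite (lt_trans t1 x1).
    have [x /andP[x1 x2]] := MVT_continuous t2 dt (fun x _ => c1 x).
    rewrite -phi10 sub0r => E; exists x; last by rewrite mulNr -E opprK.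
    by apply: hd; rewrite ler_norml; lra.
  have pn : p 1 < 0.
    rewrite lt_neqAle p1 /= leNgt; apply/negP => pp.
    pose t := 1 - Num.min d 1.
    have m0 : 0 < Num.min d 1 by rewrite lt_min d0 ltr01.
    have m1 : Num.min d 1 <= 1 by rewrite ge_min lexx orbT.
    have md : Num.min d 1 <= d by rewrite ge_min lexx.
    have tI : -1 < t < 1 by rewrite /t; lra.
    have td : 1 - t <= d by rewrite /t; lra.
    have [x hx E] := main t tI td.
    have := hpos t tI; rewrite E.
    rewrite (gtr0_norm pp) ler_norml in hx.
    apply/negP; rewrite -leNgt mulr_le0_ge0 //; first lra.
    by rewrite /t; lra.
  exists (Num.min d 1); first by rewrite lt_min d0 ltr01 ge_min lexx orbT.
  exists (- p 1 / 2); first by rewrite divr_gt0 // oppr_gt0.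
  move=> t /andP[t1 t2].
  have m1 : Num.min d 1 <= 1 by rewrite ge_min lexx orbT.
  have md : Num.min d 1 <= d by rewrite ge_min lexx.
  have := t2; rewrite le_eqVlt => /predU1P[->|t2'].
    by rewrite subrr mulr0 phi1.
  have tI : -1 < t < 1 by rewrite t2' andbT; lra.
  have td : 1 - t <= d by lra.
  have [x hx ->] := main t tI td.
  rewrite ler_wpM2r ?subr_ge0 //.
  by rewrite (ltr0_norm pn) ler_norml in hx; lra.
have e0 : 0 < phi 1 / 2 by rewrite divr_gt0.
have [d d0 hd] := continuous_for_ball (c1 1) e0.
exists (Num.min d 1); first by rewrite lt_min d0 ltr01 ge_min lexx orbT.
exists (phi 1 / 2) => // t /andP[t1 t2].
have m1 : Num.min d 1 <= 1 by rewrite ge_min lexx orbT.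
have md : Num.min d 1 <= d by rewrite ge_min lexx.
have : `|t - 1| <= d by rewrite ler_norml; lra.
move=> /hd; rewrite ler_norml => /andP[h _].
have : phi 1 / 2 * (1 - t) <= phi 1 / 2 * 1 by rewrite ler_wpM2l ?(ltW e0) //; lra.
by lra.
Qed.

Lemma le0_of_linear_bound (x C b : R) : 0 <= C -> 0 < b ->
  (forall e, 0 < e -> e <= b -> x <= C * e) -> x <= 0.
Proof.
move=> C0 b0 hx; rewrite leNgt; apply/negP => x0.
have C1 : 0 < 2 * (C + 1) by rewrite mulr_gt0 // ltr_wpDl.
pose e := Num.min b (x / (2 * (C + 1))).
have e0 : 0 < e by rewrite lt_min b0 divr_gt0.
have eb : e <= b by rewrite ge_min lexx.
have : e * (2 * (C + 1)) <= x by rewrite -ler_pdivlMr // ge_min lexx orbT.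
by have := hx e e0 eb; nra.
Qed.

(* Picone's identity for (u'/k)' = (1 - m a) u and (v'/k')' = (1 - m a) v:
   the derivative of u u'/k - u^2 v'/(k' v) is
   (1/k - 1/k') u'^2 + (u' - u v'/v)^2 / k'. *)
Lemma shot_picone k k' m u u' v v' : 0 < k -> k < k' ->
  shot a k m u u' -> shot a k' m v v' ->
  (forall t : R, -1 < t < 1 -> 0 < u t) -> u 1 = 0 ->
  (forall t : R, -1 < t < 1 -> 0 < v t) -> False.
Proof.
move=> k0 kk' hu hv u0 u1 v0.
have k'0 : 0 < k' by exact: lt_trans kk'.
have [cu cu' [iu iu'] du du'] := hu.
have [cv cv' [iv iv'] dv dv'] := hv.
have N11 : (-1 : R) <= 1 by rewrite (le_trans (lerN10 R) ler01).
have [B B0 hB] := continuous_bounded_itv N11 (fun x _ => cu' x).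
have [D D0 hD] := continuous_bounded_itv N11 (fun x _ => cv' x).
have ub s t : -1 <= s -> s <= t -> t <= 1 -> `|u t - u s| <= B * (t - s).
  move=> s1; rewrite le_eqVlt => /predU1P[->|st] t1; first by rewrite !subrr normr0 mulr0.
  have du_st x : s < x < t -> is_derive x (1 : R) u (u' x).
    by move=> /andP[x1 x2]; apply: du; rewrite (le_lt_trans s1 x1) (lt_le_trans x2 t1).
  have [x /andP[x1 x2] ->] := MVT_continuous st du_st (fun x _ => cu x).
  rewrite normrM (ger0_norm (x := t - s)) ?subr_ge0 ?(ltW st) //.
  rewrite ler_wpM2r ?subr_ge0 ?(ltW st) //.
  by apply: hB; rewrite (le_trans s1 (ltW x1)) (le_trans (ltW x2) t1).
pose G t := u t * u' t / k - u t ^+ 2 * v' t / (k' * v t).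
(* At distance [s] from an end, [u <= B s] and [v >= c s], so [u^2 / v] is still of order [s]: [G]
   tends to 0 at both ends. *)
have Gb c s t : 0 < c -> 0 <= s -> -1 < t < 1 -> u t <= B * s -> c * s <= v t ->
    `|G t| <= (B * B / k + B ^+ 2 * D / (k' * c)) * s.
  move=> c0 s0 tI uB vs.
  have tJ : -1 <= t <= 1 by case/andP: tI => /ltW -> /ltW ->.
  have ut := u0 t tI; have vt := v0 t tI.
  have sp : 0 < s.
    rewrite lt_neqAle s0 andbT; apply/eqP => s00.
    by move: uB; rewrite -s00 mulr0 leNgt ut.
  rewrite /G (le_trans (ler_normB _ _)) // mulrDl lerD //.
    rewrite !normrM normfV (gtr0_norm k0) (gtr0_norm ut).
    rewrite [leRHS]mulrAC ler_wpM2r ?invr_ge0 ?(ltW k0) //.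
    rewrite [leRHS]mulrAC ler_pM ?(ltW ut) //; exact: hB.
  rewrite normrM normfV (gtr0_norm (x := k' * v t)) ?mulr_gt0 //.
  rewrite normrM (ger0_norm (sqr_ge0 (u t))).
  apply: (@le_trans _ _ ((B * s) ^+ 2 * D / (k' * (c * s)))).
    apply: ler_pM.
    - by rewrite mulr_ge0 // sqr_ge0.
    - by rewrite invr_ge0 mulr_ge0 // ltW.
    - apply: ler_pM => //; [exact: sqr_ge0| |exact: hD].
      by rewrite ler_sqr ?nnegrE ?mulr_ge0 // ltW.
    - by rewrite lef_pV2 ?posrE ?mulr_gt0 // ler_wpM2l // ltW.
  rewrite le_eqVlt; apply/orP; left; apply/eqP; field.
  by rewrite !gt_eqF.
have dG t : -1 < t < 1 -> is_derive t (1 : R) G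
    ((k^-1 - k'^-1) * u' t ^+ 2 + k'^-1 * (u' t - u t * v' t / v t) ^+ 2).
  move=> tI; have vt : v t != 0 by rewrite gt_eqF ?v0.
  have h1 := is_derive1_mul (is_derive1_mul (du t tI) (du' t tI)) (is_derive_cst k^-1 t (1 : R)).
  have h2 := is_derive1_inv (is_derive1_mul (is_derive_cst k' t (1 : R)) (dv t tI)).
  have h3 := is_derive1_mul (is_derive1_mul (is_derive1_exprn 2 (du t tI)) (dv' t tI)) (h2 _).
  have kv : cst k' t * v t != 0 by rewrite mulf_neq0 // gt_eqF.
  apply: (is_derive_eq (is_derive1_sub h1 (h3 kv))).
  rewrite /cst /=; field.
  by rewrite vt !gt_eqF.
have dG0 t : -1 < t < 1 -> 0 <= (k^-1 - k'^-1) * u' t ^+ 2 + k'^-1 * (u' t - u t * v' t / v t) ^+ 2.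
  move=> tI; rewrite addr_ge0 // mulr_ge0 ?sqr_ge0 ?invr_ge0 ?(ltW k'0) //.
  by rewrite subr_ge0 lef_pV2 ?posrE // ltW.
have Gmono s t : -1 < s -> s <= t -> t < 1 -> G s <= G t.
  move=> s1 st t1.
  apply: (le_of_derive_ge0 st (df := fun t => (k^-1 - k'^-1) * u' t ^+ 2 + k'^-1 * (u' t - u t * v' t / v t) ^+ 2)).
  - by move=> x /andP[x1 x2]; apply: dG; rewrite (lt_trans s1 x1) (lt_trans x2 t1).
  - move=> x /andP[x1 x2]; apply: is_derive1_continuous (dG x _).
    by rewrite (lt_le_trans s1 x1) (le_lt_trans x2 t1).
  - by move=> x /andP[x1 x2]; apply: dG0; rewrite (lt_trans s1 x1) (lt_trans x2 t1).
have inI (e : R) : 0 < e -> e <= 1 -> -1 < -1 + e < 1 /\ -1 < 1 - e < 1.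
  by clear=> e0 e1; split; lra.
(* [G] is nondecreasing with limit 0 at -1. The factor [2^-1] in [C] is the slope granted by
   [shot_near_left]. *)
have G_ge0 t : -1 < t < 1 -> 0 <= G t.
  move=> /andP[t1 t2].
  have [d /andP[d0 dle1] hd] := shot_near_left hv.
  set C := B * B / k + B ^+ 2 * D / (k' * 2^-1).
  have C0 : 0 <= C.
    by rewrite addr_ge0 // !mulr_ge0 ?invr_ge0 ?mulr_ge0 ?sqr_ge0 ?(ltW k0) ?(ltW k'0).
  rewrite -oppr_le0; apply: (@le0_of_linear_bound _ C (Num.min d (t + 1))) => //.
    by rewrite lt_min d0 -ltrBlDr sub0r.
  move=> e e0; rewrite le_min => /andP[ed et].
  have [eI _] := inI e e0 (le_trans ed dle1).
  have se : -1 + e + 1 = e by rewrite addrAC addNr add0r.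
  apply: (@le_trans _ _ `|G (-1 + e)|).
    rewrite -normrN; apply: le_trans (ler_norm _); rewrite lerN2; apply: Gmono => //.
      by case/andP: eI.
    by rewrite addrC lerBlDr.
  apply: Gb => //; first exact: ltW.
  - have /andP[/ltW h1 /ltW h2] := eI.
    have := ub (-1) (-1 + e) (lexx _) h1 h2.
    by rewrite iu subr0 opprK se; apply: le_trans; exact: ler_norm.
  - rewrite mulrC -{1}se; apply: (hd v v' m hv) => [x _|].
      by rewrite subrr normr0 invr_ge0.
    by rewrite lerD2l ed andbT; case/andP: eI => /ltW.
have G_le0 t : -1 < t < 1 -> G t <= 0.
  move=> /andP[t1 t2].
  (* Here [v 1] may be zero or positive; the linear lower bound holds in both cases. *)
  have [d /andP[d0 dle1] [c c0 vr]] := shot_near_right (ltW k'0) hv v0.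
  set C := B * B / k + B ^+ 2 * D / (k' * c).
  have C0 : 0 <= C.
    by rewrite addr_ge0 // !mulr_ge0 ?invr_ge0 ?mulr_ge0 ?sqr_ge0 ?(ltW k0) ?(ltW k'0) ?(ltW c0).
  apply: (@le0_of_linear_bound _ C (Num.min d (1 - t))) => //.
    by rewrite lt_min d0 subr_gt0.
  move=> e e0; rewrite le_min => /andP[ed et].
  have [_ eI] := inI e e0 (le_trans ed dle1).
  have se : 1 - (1 - e) = e by rewrite opprB addrC subrK.
  apply: (@le_trans _ _ `|G (1 - e)|).
    apply: le_trans (ler_norm _); apply: Gmono => //; last by case/andP: eI.
    by rewrite lerBrDl -lerBrDr.
  apply: Gb => //; first exact: ltW.
  - have /andP[/ltW h1 /ltW h2] := eI.
    have := ub (1 - e) 1 h1 h2 (lexx _).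
    by rewrite u1 sub0r normrN se; apply: le_trans; exact: ler_norm.
  - rewrite -{1}se; apply: vr.
    by rewrite lerD2l lerN2 ed gerBl ltW.
(* [G] is identically 0, so both squares in its derivative vanish; as [k < k'], the coefficient of
   [u'^2] is positive. Then [u] is constant, equal to [u (-1) = 0], which contradicts its
   positivity. *)
have u'0 t : -1 < t < 1 -> u' t = 0.
  move=> tI.
  have Gz s : s \in `]-1, 1[ -> G s = 0.
    by rewrite in_itv /= => sI; apply/eqP; rewrite eq_le G_ge0 // G_le0.
  have D0' : is_derive t (1 : R) G 0.
    apply: (@is_derive1_eq_on _ `]-1, 1[%classic (fun=> 0)).
    - exact: itv_open.
    - by rewrite /= in_itv.
    - by move=> y /= yI; rewrite Gz.
  have := is_derive1_derive1 (dG t tI).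
  rewrite (is_derive1_derive1 D0') => /esym/eqP.
  have kk : 0 < k^-1 - k'^-1 by rewrite subr_gt0 ltf_pV2 ?posrE.
  rewrite paddr_eq0; first last.
  - by apply: mulr_ge0; [rewrite invr_ge0 ltW|exact: sqr_ge0].
  - by apply: mulr_ge0; [exact: ltW|exact: sqr_ge0].
  move=> /andP[].
  by rewrite mulf_eq0 (gt_eqF kk) /= sqrf_eq0 => /eqP.
have lt10 : (-1 : R) < 0 by rewrite ltrN10.
have du0 (x : R) : -1 < x < 0 -> is_derive x (1 : R) u (u' x).
  by move=> /andP[x1 x2]; apply: du; rewrite x1 (lt_trans x2).
have [x /andP[x1 x2]] := MVT_continuous lt10 du0 (fun x _ => cu x).
have xI : -1 < x < 1 by rewrite x1 (lt_trans x2).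
rewrite iu subr0 u'0 // mul0r => u00.
have := u0 0; rewrite u00 ltxx => h; suff: false by [].
by apply: h; rewrite ltrN10 ltr01.
Qed.

(** At the infimum of the failing parameters positivity still fails, because it is an open
    condition; yet the shot is a limit of positive ones, hence nonnegative and without interior
    zeros. The only failure left is a zero at 1. Minimality is exported because later comparisons
    rest on it. *)
Lemma principal_exists k S : 0 < k -> 0 < S ->
  (forall t : R, -1 < t < 1 -> a t <= S) ->
  (exists m phi p, [/\ 0 < m, shot a k m phi p & ~ positive_shot phi]) ->
  exists m phi p, [/\ S^-1 <= m, shot a k m phi p,
    forall t : R, -1 < t < 1 -> 0 < phi t, phi 1 = 0
    & forall m' phi' p', 0 < m' -> m' < m -> shot a k m' phi' p' ->
        positive_shot phi'].
Proof.
move=> k0 S0 haS [m0 [phi0 [p0 [m00 hs0 np0]]]].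
pose Z := [set m | 0 < m /\ exists phi p, shot a k m phi p /\ ~ positive_shot phi].
have Zlb m : Z m -> S^-1 <= m.
  move=> [m1 [phi [p [hs]]]] np; rewrite leNgt; apply/negP => mS; apply: np.
  apply: (shot_le_sup_positive (ltW k0) (ltW m1) _ haS hs).
  by rewrite -ler_pdivlMr // mul1r ltW.
have Zne : Z !=set0 by exists m0; split=> //; exists phi0, p0.
have Zinf : has_inf Z by split=> //; exists S^-1 => m; exact: Zlb.
pose m := inf Z; have mS : S^-1 <= m by apply: lb_le_inf.
have m_gt0 : 0 < m by apply: lt_le_trans mS; rewrite invr_gt0.
have [phi [p hs]] := shot_exists ca ba k m.
have below m' phi' p' : 0 < m' -> m' < m -> shot a k m' phi' p' -> positive_shot phi'.
  move=> m'0 m'm hs'; apply: contrapT => np.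
  have : m <= m' by apply: ge_inf; [exact: Zinf.2|split=> //; exists phi', p'].
  by rewrite leNgt m'm.
have np : ~ positive_shot phi.
  move=> hp; have [e e0 he] := shot_stable ba (ltW k0) hs hp.
  have [m' [m'0 [phi' [p' [hs' np']]]] m'm] := inf_adherent e0 Zinf.
  have mm : m <= m' by apply: ge_inf; [exact: Zinf.2|split=> //; exists phi', p'].
  apply: np'; apply: he hs'.
  by rewrite ger0_norm ?subr_ge0 // lerBlDl ltW.
(* [m] is approached from below by [m - e], whose shots are positive; if [phi t < 0], Lipschitz
   dependence would make one of them negative at [t]. The bound [e <= m / 2] keeps the parameter
   positive. *)
have ge0 t : -1 < t <= 1 -> 0 <= phi t.
  move=> tI; rewrite leNgt; apply/negP => phit.
  have [C C0 hC] := shot_lipschitz ba (ltW k0) hs.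
  have C1 : 0 < C + 1 by lra.
  pose e := Num.min (Num.min 1 (m / 2)) (- phi t / (C + 1)).
  have e0 : 0 < e by rewrite !lt_min ltr01 /= divr_gt0 //= divr_gt0 // oppr_gt0.
  have e1 : e <= 1 by rewrite !ge_min lexx.
  have em : e <= m / 2 by rewrite !ge_min lexx orbT.
  have ep : e * (C + 1) <= - phi t by rewrite -ler_pdivlMr // !ge_min lexx orbT.
  have [phi' [p' hs']] := shot_exists ca ba k (m - e).
  have hp' : positive_shot phi' by apply: below hs'; lra.
  have nm : `|m - e - m| = e by rewrite addrAC subrr sub0r normrN gtr0_norm.
  have tJ : -1 <= t <= 1 by case/andP: tI => /ltW -> ->.
  have nm1 : `|m - e - m| <= 1 by rewrite nm.
  have [] := hC _ _ _ nm1 hs' t tJ.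
  by rewrite nm ler_norml => /andP[h1 h2] _; have := hp' t tI; nra.
have gt0 t : -1 < t < 1 -> 0 < phi t.
  move=> tI; rewrite lt_neqAle ge0 ?andbT; last by case/andP: tI => -> /ltW.
  apply/eqP => /esym phit; apply: (shot_no_interior_zero ba (ltW k0) hs tI phit) => s sI.
  by apply: ge0; case/andP: sI => -> /ltW.
exists m, phi, p; split=> //.
apply: contrapT => phi1; apply: np => t /andP[t1].
rewrite le_eqVlt => /predU1P[->|t2]; last by apply: gt0; rewrite t1.
rewrite lt_neqAle ge0 ?andbT; last by rewrite lexx (lt_trans (ltrN10 R) ltr01).
by apply/eqP => /esym.
Qed.

Lemma oscillation_interval e : (exists2 t, -1 < t < 1 & e < a t) ->
  exists c d : R, [/\ -1 < c, c < d, d < 1 & forall t, c <= t <= d -> e <= a t].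
Proof.
move=> [s /andP[s1 s2] es].
have e0 : 0 < a s - e by rewrite subr_gt0.
have sI : -1 < s < 1 by rewrite s1.
have [d d0 hd] := continuous_for_ball (ca sI) e0.
exists s, (s + Num.min d ((1 - s) / 2)).
have m0 : 0 < Num.min d ((1 - s) / 2) by rewrite lt_min d0 divr_gt0 // subr_gt0.
have m1 : Num.min d ((1 - s) / 2) <= d by rewrite ge_min lexx.
have m2 : Num.min d ((1 - s) / 2) <= (1 - s) / 2 by rewrite ge_min lexx orbT.
split=> //; try lra.
move=> t /andP[t1 t2]; have : `|t - s| <= d by rewrite ger0_norm; lra.
by move=> /hd; rewrite ler_norml; lra.
Qed.

(** Where [a >= e] the coefficient is at most [- k (m e - 1)], which is unbounded below in [k]; [K]
    is the value at which it reaches minus the squared frequency of the comparison sine. *)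
Lemma shot_eventually_oscillates e m : 0 <= m -> 1 < m * e ->
  (exists2 t, -1 < t < 1 & e < a t) ->
  exists2 K : R, 0 < K & forall k phi p, K <= k -> shot a k m phi p -> ~ positive_shot phi.
Proof.
move=> m0 me /oscillation_interval[c [d [c1 cd d1 hcd]]].
have w0 : 0 < (pi / (d - c)) ^+ 2 by rewrite exprn_gt0 // divr_gt0 ?pi_gt0 ?subr_gt0.
have me0 : 0 < m * e - 1 by rewrite subr_gt0.
exists ((pi / (d - c)) ^+ 2 / (m * e - 1)); first exact: divr_gt0.
move=> k phi p kK hs; apply: (shot_oscillates c1 cd d1 _ hs) => t tcd.
have k0 : 0 <= k by apply: le_trans kK; exact/ltW/divr_gt0.
move: kK; rewrite ler_pdivrMr // => h.
have h1 : k * (1 - m * a t) <= k * (1 - m * e).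
  by rewrite ler_wpM2l // lerD2l lerN2 ler_wpM2l // hcd.
by apply: le_trans h1 _; rewrite -opprB mulrN lerN2.
Qed.

Lemma principal_sequence S : 0 < S ->
  (forall t : R, -1 < t < 1 -> a t <= S) ->
  (forall e : R, e < S -> exists2 t, -1 < t < 1 & e < a t) ->
  exists (m : nat -> R) (phi p : nat -> R -> R),
  [/\ forall n, (1 <= n)%N -> [/\ 0 < m n, shot a (n%:R ^+ 2) (m n) (phi n) (p n),
        forall t : R, -1 < t < 1 -> 0 < phi n t & phi n 1 = 0],
      forall i j, (1 <= i)%N -> (i < j)%N -> (m j)^-1 > (m i)^-1
    & (m n)^-1 @[n --> \oo] --> S].
Proof.
move=> S0 haS hS.
have ex n : exists mf : R * ((R -> R) * (R -> R)), (1 <= n)%N ->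
    [/\ S^-1 <= mf.1, shot a (n%:R ^+ 2) mf.1 mf.2.1 mf.2.2,
    forall t : R, -1 < t < 1 -> 0 < mf.2.1 t, mf.2.1 1 = 0
    & forall m' phi' p', 0 < m' -> m' < mf.1 -> shot a (n%:R ^+ 2) m' phi' p' ->
        positive_shot phi'].
  (* Index 0 receives a dummy value, since the claim starts at 1. *)
  case: n => [|n]; first by exists (0, (id, id)).
  have k0 : 0 < n.+1%:R ^+ 2 :> R by rewrite exprn_gt0 // ltr0n.
  have S2 : S / 2 < S by rewrite ltr_pdivrMr // ltr_pMr // ltr1n.
  have [c [d [c1 cd d1 hcd]]] := oscillation_interval (hS _ S2).
  pose w := (pi / (d - c)) ^+ 2; have w0 : 0 <= w by rewrite sqr_ge0.
  (* Solves [k (1 - m S / 2) = - w] with [k = n.+1 ^ 2], so that the comparison sine applies where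
     [a >= S / 2]. *)
  pose m := (1 + w / n.+1%:R ^+ 2) / (S / 2).
  have m0 : 0 < m by rewrite !divr_gt0 // ltr_wpDr // divr_ge0 // ltW.
  have [phi0 [p0 hs0]] := shot_exists ca ba (n.+1%:R ^+ 2) m.
  have np0 : ~ positive_shot phi0.
    apply: (shot_oscillates c1 cd d1 _ hs0) => t tcd.
    have h1 : n.+1%:R ^+ 2 * (1 - m * a t) <= n.+1%:R ^+ 2 * (1 - m * (S / 2)).
      by rewrite ler_wpM2l ?(ltW k0) // lerD2l lerN2 ler_wpM2l ?(ltW m0) // hcd.
    apply: le_trans h1 _; rewrite /m divfK; last by rewrite gt_eqF // divr_gt0.
    by rewrite opprD addrA subrr sub0r mulrN mulrCA mulfV ?mulr1 // gt_eqF.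
  have exm : exists m phi p, [/\ 0 < m, shot a (n.+1%:R ^+ 2) m phi p & ~ positive_shot phi].
    by exists m, phi0, p0.
  have [m1 [phi [p [h1 h2 h3 h4 h5]]]] := principal_exists k0 S0 haS exm.
  by exists (m1, (phi, p)).
have [F hF] := choice ex.
exists (fun n => (F n).1), (fun n => (F n).2.1), (fun n => (F n).2.2).
have Sm n : (1 <= n)%N -> S^-1 <= (F n).1 by move=> /hF[].
have m0 n : (1 <= n)%N -> 0 < (F n).1.
  by move=> n1; apply: lt_le_trans (Sm n n1); rewrite invr_gt0.
split.
- by move=> n n1; have [_ h2 h3 h4 _] := hF n n1; split=> //; exact: m0.
- move=> i j i1 ij; have j1 : (1 <= j)%N by exact: leq_trans (ltnW ij).
  have [_ hi1 hi2 hi3 _] := hF i i1; have [_ hj1 hj2 _ hj4] := hF j j1.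
  rewrite ltf_pV2 ?posrE ?m0 // ltNge; apply/negP => mij.
  have i0 : 0 < i%:R ^+ 2 :> R by rewrite exprn_gt0 // ltr0n.
  have lij : i%:R ^+ 2 < j%:R ^+ 2 :> R.
    by rewrite ltr_sqr ?nnegrE ?ler0n // ltr_nat.
  (* With [m i <= m j], wave number [j] has a positive shot at the parameter [m i]: the principal
     one if the two are equal, any one by minimality of [m j] otherwise. Picone's identity at [m i]
     excludes both. *)
  move: mij; rewrite le_eqVlt => /predU1P[E|mij].
    by rewrite -E in hj1; exact: (shot_picone i0 lij hi1 hj1 hi2 hi3 hj2).
  have [v [v' hv]] := shot_exists ca ba (j%:R ^+ 2) (F i).1.
  apply: (shot_picone i0 lij hi1 hv hi2 hi3) => t tI.
  by apply: (hj4 _ _ _ (m0 i i1) mij hv); case/andP: tI => -> /ltW.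
- apply/cvgrPdist_le => e e0.
  (* [l] is positive and within [e] of [S]. The level [g] lies strictly between [l] and [S]: it is
     exceeded by [a] somewhere, and [g / l > 1], so for large [n] the shots at [1 / l] fail and
     minimality gives [m n <= 1 / l]. *)
  pose l := Num.max (S / 2) (S - e / 2).
  have lS : l < S by rewrite gt_max; apply/andP; split; lra.
  have l0 : 0 < l by rewrite lt_max divr_gt0.
  have le : S - l <= e by rewrite lerBlDl -lerBlDr le_max; apply/orP; right; lra.
  pose g := (l + S) / 2; have gS : g < S by rewrite /g; lra.
  have lg : 1 < l^-1 * g by rewrite mulrC ltr_pdivlMr // mul1r /g; lra.
  have il0 : 0 <= l^-1 by rewrite invr_ge0 ltW.
  have [K K0 hK] := shot_eventually_oscillates il0 lg (hS _ gS).
  near=> n.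
  have Nn : ((Num.truncn K).+1 <= n)%N by near: n; exact: nbhs_infty_ge.
  have n1 : (1 <= n)%N by exact: leq_trans Nn.
  have Kn : K <= n%:R ^+ 2.
    have h1 : K <= n%:R.
      apply: (@le_trans _ _ (Num.truncn K).+1%:R); last by rewrite ler_nat.
      exact/ltW/truncnS_gt.
    apply: le_trans h1 _; rewrite expr2 ler_peMr ?ler0n // ler1n //.
  have [hn1 hn2 _ _ hn4] := hF n n1.
  have ml : (F n).1 <= l^-1.
    rewrite leNgt; apply/negP => h.
    have [v [v' hv]] := shot_exists ca ba (n%:R ^+ 2) l^-1.
    apply: (hK _ _ _ Kn hv); apply: (hn4 _ _ _ _ h hv); by rewrite invr_gt0.
  have h1 : l <= (F n).1^-1 by rewrite -[leLHS]invrK lef_pV2 // posrE ?invr_gt0 // m0.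
  have h2 : (F n).1^-1 <= S by rewrite -[leRHS]invrK lef_pV2 // posrE ?invr_gt0 // m0.
  by rewrite ger0_norm ?subr_ge0 //; lra.
Unshelve. all: by end_near. Qed.

End principal_eigenvalue.

(** * Integration over the periodic strip *)

Section omega_integrals.
Context {R : realType}.
Notation mu := (@lebesgue_measure R).
Notation R2 := (measurableTypeR R * measurableTypeR R)%type.
Implicit Types (f F : R * R -> R) (c g : R -> R).

Lemma OmegaE (x y : R) : Omega R (x, y) <-> 0 <= x < 2 * pi /\ -1 < y < 1.
Proof. by rewrite /Omega /= !in_itv /=; split. Qed.

Lemma measurable_Omega : measurable (Omega R : set R2).
Proof. exact: (measurableX (measurable_itv _) (measurable_itv _)). Qed.

Lemma area_Omega : (area R (Omega R : set R2) < +oo)%E.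
Proof.
rewrite /Omega product_measure1E; [|exact: measurable_itv|exact: measurable_itv].
rewrite [X in (X * _)%E](_ : _ = mu [set` `[0, 2 * pi[]) // lebesgue_measure_itv /=.
rewrite [X in (_ * X)%E](_ : _ = mu [set` `]-1, 1[]) // lebesgue_measure_itv /=.
by rewrite !lte_fin; case: ifP; case: ifP => _ _; rewrite ?mule0 ?mul0e // -!EFinB -EFinM ltry.
Qed.

(** Measurability refers to the product sigma-algebra, which must be shown to contain the open sets
    of the plane: each is a countable union of boxes with rational corners. *)
Lemma continuous_measurable2 (f : R * R -> R) : continuous f ->
  measurable_fun (setT : set R2) (f : R2 -> measurableTypeR R).
Proof.
move=> /continuousP cf; apply: (measurability _ (RGenOpens.measurableE R)).
move=> _ [_ [a [b ->] <-]]; rewrite setTI.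
set U := f @^-1` _; have oU : open U by exact: cf (interval_open _ _).
pose box (s : rat * rat * (rat * rat)) : set (R * R) :=
  `](ratr s.1.1), (ratr s.1.2)[ `*` `](ratr s.2.1), (ratr s.2.2)[.
have -> : U = \bigcup_(s in [set s | box s `<=` U]) box s.
  apply/seteqP; split => [[x y] Uxy|z [s /= sU]]; last exact: sU.
  have := open_nbhs_nbhs (conj oU Uxy).
  move=> /nbhs_ballP[e /= e0 he].
  have hx1 : x - e < x by rewrite ltrBlDr ltrDl.
  have hx2 : x < x + e by rewrite ltrDl.
  have hy1 : y - e < y by rewrite ltrBlDr ltrDl.
  have hy2 : y < y + e by rewrite ltrDl.
  have [p1 /itvP hp1] := rat_in_itvoo hx1.
  have [p2 /itvP hp2] := rat_in_itvoo hx2.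
  have [q1 /itvP hq1] := rat_in_itvoo hy1.
  have [q2 /itvP hq2] := rat_in_itvoo hy2.
  exists ((p1, p2), (q1, q2)) => /=; last by rewrite /box /= !in_itv /= hp1 hp2 hq1 hq2.
  move=> [x' y']; rewrite /box /= !in_itv /= => -[/andP[h1 h2] /andP[h3 h4]].
  apply: he; split; rewrite /ball /= ltr_norml; apply/andP; split.
  - have hh : ratr p2 < x + e by rewrite hp2.
    lra.
  - have hh : x - e < ratr p1 by rewrite hp1.
    lra.
  - have hh : ratr q2 < y + e by rewrite hq2.
    lra.
  - have hh : y - e < ratr q1 by rewrite hq1.
    lra.
rewrite bigcup_mkcond; apply: countable_bigcupT_measurable; first exact: countableP.
move=> s; case: ifP => // _; exact: (measurableX (measurable_itv _) (measurable_itv _)).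
Qed.

Definition tensor c g (z : R * R) : R := c z.1 * g z.2.

Lemma measurable_tensor c g : continuous c -> C0 `]-1, 1[%classic false g ->
  measurable_fun (Omega R : set R2) (tensor c g : R2 -> measurableTypeR R).
Proof.
move=> cc [cg _].
apply: (@measurable_funM _ R2 R (Omega R) (fun z => c z.1) (fun z => g z.2)).
- apply: measurable_funTS; apply: measurableT_comp.
    exact: continuous_measurable_fun.
  exact: measurable_fst.
- apply: (@measurable_comp _ _ _ R2 (measurableTypeR R) (measurableTypeR R)
    `]-1, 1[%classic g (Omega R) snd).
  + exact: measurable_itv.
  + by move=> _ [[x y] [_ hy] <-].
  + apply: (open_continuous_measurable_fun (itv_open _ _)) => y.
    by rewrite inE; exact: cg.
  + exact: measurable_funTS measurable_snd.
Qed.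

Lemma bounded_integrable_Omega F (M : R) :
  measurable_fun (Omega R : set R2) (F : R2 -> measurableTypeR R) ->
  (forall z, Omega R z -> `|F z| <= M) ->
  (area R).-integrable (Omega R : set R2) (EFin \o F).
Proof.
move=> mF bF; apply: measurable_bounded_integrable => //.
- exact: measurable_Omega.
- exact: area_Omega.
- exists M; split; first exact: num_real.
  by move=> N MN z Oz; exact: le_trans (bF z Oz) (ltW MN).
Qed.

(** The form of Fubini suited to integration by parts, where the integrand on each slice is the
    derivative of a function with equal values at the ends. *)
Lemma integral_slices_x F (M : R) :
  measurable_fun (Omega R : set R2) (F : R2 -> measurableTypeR R) ->
  (forall z, Omega R z -> `|F z| <= M) ->
  (forall y : R, -1 < y < 1 ->
     (\int[mu]_(x in `[0%R, (2 * pi)%R[) (F (x, y))%:E = 0)%E) ->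
  \int[area R]_(z in Omega R) F z = 0.
Proof.
move=> mF bF hF.
have iF := bounded_integrable_Omega mF bF.
rewrite /Rintegral integral_mkcond.
have iF' : (area R).-integrable setT ((EFin \o F) \_ (Omega R)).
  apply/(integrable_restrict _ measurable_Omega) => //.
  by rewrite setTI.
rewrite -(integral21_prod_meas1 iF') integral0_eq // => y _.
rewrite /fubini_G.
have [yI|yI] := boolP (-1 < y < 1).
  rewrite -[RHS](hF y yI) [RHS]integral_mkcond; apply: eq_integral => x _.
  rewrite !patchE; congr (if _ then _ else _).
  apply/idP/idP => [/set_mem[h _]|/set_mem h]; first exact: mem_set.
  by apply: mem_set; split => //=; rewrite in_itv.
apply: integral0_eq => x _; rewrite patchE memNset // => -[_].
by rewrite /= in_itv /= => h; rewrite h in yI.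
Qed.

Lemma integral_slices_y F (M : R) :
  measurable_fun (Omega R : set R2) (F : R2 -> measurableTypeR R) ->
  (forall z, Omega R z -> `|F z| <= M) ->
  (forall x : R, 0 <= x < 2 * pi ->
     (\int[mu]_(y in `](-1)%R, 1%R[) (F (x, y))%:E = 0)%E) ->
  \int[area R]_(z in Omega R) F z = 0.
Proof.
move=> mF bF hF.
have iF := bounded_integrable_Omega mF bF.
rewrite /Rintegral integral_mkcond.
have iF' : (area R).-integrable setT ((EFin \o F) \_ (Omega R)).
  apply/(integrable_restrict _ measurable_Omega) => //.
  by rewrite setTI.
rewrite -(integral12_prod_meas1 iF') integral0_eq // => x _.
rewrite /fubini_F.
have [xI|xI] := boolP (0 <= x < 2 * pi).
  rewrite -[RHS](hF x xI) [RHS]integral_mkcond; apply: eq_integral => y _.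
  rewrite !patchE; congr (if _ then _ else _).
  apply/idP/idP => [/set_mem[_ h]|/set_mem h]; first exact: mem_set.
  by apply: mem_set; split => //=; rewrite in_itv.
apply: integral0_eq => y _; rewrite patchE memNset // => -[].
by rewrite /= in_itv /= => h; rewrite h in xI.
Qed.

Lemma integral_Omega_cvg0 (F : nat -> R * R -> R) (M : R) :
  (forall n, measurable_fun (Omega R : set R2) (F n : R2 -> measurableTypeR R)) ->
  (forall n z, Omega R z -> `|F n z| <= M) ->
  (forall z, Omega R z -> F n z @[n --> \oo] --> (0 : R)) ->
  (\int[area R]_(z in Omega R) (F n z)%:E @[n --> \oo] --> 0%E)%E.
Proof.
move=> mF bF cF.
have h1 n : measurable_fun (Omega R : set R2) (EFin \o F n).
  by apply/measurable_EFinP; exact: mF.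
have h2 : measurable_fun (Omega R : set R2) (EFin \o (fun=> 0 : R)).
  by apply/measurable_EFinP; exact: measurable_cst.
have h3 : {ae area R, forall z, (Omega R : set R2) z ->
    (EFin \o F n) z @[n --> \oo] --> (EFin \o (fun=> 0 : R)) z}.
  by apply: aeW => z Oz; apply: cvg_EFin; [exact: nearW|exact: cF].
have h4 : (area R).-integrable (Omega R : set R2) (EFin \o (fun=> M)).
  apply: (@bounded_integrable_Omega _ `|M|) => //; exact: measurable_cst.
have h5 : {ae area R, forall z n, (Omega R : set R2) z ->
    (`|(EFin \o F n) z| <= (EFin \o (fun=> M)) z)%E}.
  by apply: aeW => z n Oz; rewrite /= lee_fin; exact: bF.
have [_ _ h] := @dominated_convergence _ _ R (area R) _ measurable_Omega _ _ _ h1 h2 h3 h4 h5.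
by move: h; rewrite [X in _ --> X]integral0_eq.
Qed.

End omega_integrals.

(** * Test functions and weak derivatives *)

Section test_functions.
Context {R : realType}.
Notation mu := (@lebesgue_measure R).
Notation R2 := (measurableTypeR R * measurableTypeR R)%type.
Implicit Types (phi : R * R -> R) (v : R * R) (c g : R -> R).

Lemma test_function_continuous phi : test_function phi -> continuous phi.
Proof. by move=> [/(_ 0%N)]. Qed.

Lemma derive_slice1 phi (x y : R) :
  (fun h : R => h^-1 *: (phi (h *: e1 R + (x, y)) - phi (x, y))) =
  (fun h : R => h^-1 *: (phi (h *: (1 : R) + x, y) - phi (x, y))).
Proof.
apply/funext => h; congr (_ *: (phi _ - _)).
by rewrite /e1; congr pair => /=; rewrite /GRing.scale /= ?mulr0 ?add0r.
Qed.

Lemma derive_slice2 phi (x y : R) :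
  (fun h : R => h^-1 *: (phi (h *: e2 R + (x, y)) - phi (x, y))) =
  (fun h : R => h^-1 *: (phi (x, h *: (1 : R) + y) - phi (x, y))).
Proof.
apply/funext => h; congr (_ *: (phi _ - _)).
by rewrite /e2; congr pair => /=; rewrite /GRing.scale /= ?mulr0 ?add0r.
Qed.

Lemma is_derive_slice1 phi (x y : R) : derivable phi (x, y) (e1 R) ->
  is_derive x (1 : R) (fun x => phi (x, y)) ('D_(e1 R) phi (x, y)).
Proof.
rewrite /derivable (derive_slice1 phi x y) => h; apply: DeriveDef => //.
by rewrite /derive (derive_slice1 phi x y).
Qed.

Lemma is_derive_slice2 phi (x y : R) : derivable phi (x, y) (e2 R) ->
  is_derive y (1 : R) (fun y => phi (x, y)) ('D_(e2 R) phi (x, y)).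
Proof.
rewrite /derivable (derive_slice2 phi x y) => h; apply: DeriveDef => //.
by rewrite /derive (derive_slice2 phi x y).
Qed.

Lemma slice1_is_derive phi (x y d : R) :
  is_derive x (1 : R) (fun x => phi (x, y)) d -> is_derive (x, y) (e1 R) phi d.
Proof.
move=> [h1 h2]; apply: DeriveDef; first by rewrite /derivable derive_slice1.
by rewrite -h2 /derive (derive_slice1 phi x y).
Qed.

Lemma slice2_is_derive phi (x y d : R) :
  is_derive y (1 : R) (fun y => phi (x, y)) d -> is_derive (x, y) (e2 R) phi d.
Proof.
move=> [h1 h2]; apply: DeriveDef; first by rewrite /derivable derive_slice2.
by rewrite -h2 /derive (derive_slice2 phi x y).
Qed.

Lemma test_function_derive phi v : v = e1 R \/ v = e2 R -> test_function phi ->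
  test_function (fun z => 'D_v phi z).
Proof.
move=> hv [hC hper [d d0 hd]]; split.
- by move=> n; have [_ _ h1 h2] := hC n.+1; case: hv => ->.
- move=> y x /=.
  have E : (fun h : R => h^-1 *: (phi (h *: v + (x + 2 * pi, y)) - phi (x + 2 * pi, y))) =
      (fun h : R => h^-1 *: (phi (h *: v + (x, y)) - phi (x, y))).
    apply/funext => h; rewrite hper; congr (_ *: (_ - _)).
    have -> : h *: v + (x + 2 * pi, y) =
        ((h *: v + (x, y)).1 + 2 * pi, (h *: v + (x, y)).2).
      by rewrite [LHS]surjective_pairing /= addrA.
    by rewrite hper -surjective_pairing.
  by rewrite /derive E.
- exists d => // x y xy.
  (* The region [1 - d < |y|] is open, so [phi] is locally zero there and the same [d] serves for
     the derivative. *)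
  rewrite (@near_eq_derive _ _ _ phi (fun=> 0)) ?derive_cst //.
  have c2 : `|z.2| @[z --> (x, y)] --> `|y|.
    apply: (@cvg_comp _ _ _ snd Num.norm _ (nbhs y)); [exact: cvg_snd|exact: norm_continuous].
  have hn : \forall z \near (x, y), 1 - d < `|z.2| by exact: cvgr_gt c2 _ xy.
  by apply: filterS hn => -[x' y'] /=; exact: hd.
Qed.

Lemma test_function_bounded phi : test_function phi ->
  exists M, forall z, Omega R z -> `|phi z| <= M.
Proof.
move=> /test_function_continuous cphi.
have K : compact (`[0, 2 * pi]%classic `*` `[-1, 1]%classic : set (R * R)).
  apply: compact_setX; exact: segment_compact.
have K0 : (`[0, 2 * pi]%classic `*` `[-1, 1]%classic : set (R * R)) !=set0.
  exists (0, 0); split; rewrite /= in_itv /=.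
    by rewrite lexx mulr_ge0 ?pi_ge0.
  by rewrite oppr_le0 ler01.
have cn : {within (`[0, 2 * pi]%classic `*` `[-1, 1]%classic : set (R * R)),
    continuous (fun z => `|phi z|)}.
  apply: continuous_subspaceT => z; apply: cvg_norm; exact: cphi.
have [c _ hc] := compact_EVT_max K0 K cn.
exists `|phi c| => -[x y] /OmegaE[/andP[x0 x1] /andP[y0 y1]]; apply: hc.
by apply: mem_set; split; rewrite /= in_itv /= ?x0 ?ltW.
Qed.

Lemma tensor_bounded c g : continuous c -> C0 `]-1, 1[%classic true g ->
  exists M, forall z, Omega R z -> `|tensor c g z| <= M.
Proof.
move=> cc [_ /(_ isT)[N hN]].
have p0 : 0 <= 2 * pi :> R by rewrite mulr_ge0 ?pi_ge0.
have [M M0 hM] := continuous_bounded_itv p0 (fun x _ => cc x).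
exists (M * N) => -[x y] /OmegaE[/andP[x0 x1] yI].
rewrite normrM ler_pM //=; last by apply: hN; rewrite /= in_itv.
by apply: hM; rewrite x0 ltW.
Qed.

Lemma C0W A b g : C0 A b g -> C0 A false g.
Proof. by move=> [h _]; split. Qed.

Lemma tensor_test c g phi : continuous c -> C0 `]-1, 1[%classic true g ->
  test_function phi ->
  measurable_fun (Omega R : set R2) ((fun z => tensor c g z * phi z) : R2 -> measurableTypeR R) /\
  exists M, forall z, Omega R z -> `|tensor c g z * phi z| <= M.
Proof.
move=> cc cg tphi; split.
  apply: (@measurable_funM _ R2 R (Omega R) (tensor c g) phi).
    exact: measurable_tensor (C0W cg).
  exact: measurable_funTS (continuous_measurable2 (test_function_continuous tphi)).
have [M hM] := tensor_bounded cc cg; have [N hN] := test_function_bounded tphi.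
by exists (M * N) => z Oz; rewrite normrM ler_pM // ?hM ?hN.
Qed.

Lemma tensor_test_integrable c g phi : continuous c ->
  C0 `]-1, 1[%classic true g -> test_function phi ->
  (area R).-integrable (Omega R : set R2) (EFin \o (fun z => tensor c g z * phi z)).
Proof.
move=> cc cg tphi; have [m [M b]] := tensor_test cc cg tphi.
exact: bounded_integrable_Omega m b.
Qed.

Lemma distr_partial1_tensor c c' g : (forall x, is_derive x (1 : R) c (c' x)) ->
  continuous c' -> c (2 * pi) = c 0 -> C0 `]-1, 1[%classic true g ->
  distr_eq (distr_partial (e1 R) (distr_of (tensor c g))) (distr_of (tensor c' g)).
Proof.
move=> dc cc' cper cg phi tphi.
have cc : continuous c by move=> x; exact: is_derive1_continuous (dc x).
have tphi1 := test_function_derive (or_introl erefl) tphi.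
have [m1 [M1 b1]] := tensor_test cc cg tphi1.
have [m2 [M2 b2]] := tensor_test cc' cg tphi.
(* With both sides gathered in one integral, the integrand on each horizontal line is the derivative
   of [c g phi], whose values at 0 and [2 pi] agree by periodicity. *)
rewrite /distr_partial /distr_of; apply/eqP; rewrite eq_sym -addr_eq0 addrC; apply/eqP.
rewrite -RintegralD; last 3 first.
- exact: measurable_Omega.
- exact: bounded_integrable_Omega m1 b1.
- exact: bounded_integrable_Omega m2 b2.
apply: (@integral_slices_x _ _ (M1 + M2)).
- exact: measurable_funD m1 m2.
- by move=> z Oz; rewrite (le_trans (ler_normD _ _)) // lerD ?b1 ?b2.
move=> y yI; have [hC hper _] := tphi.
have [hd1 _ hc1 _] := hC 1%N.
have slice_cont (psi : R * R -> R) : continuous psi -> continuous (fun x => psi (x, y)).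
  move=> cpsi x; apply: (@continuous_comp _ _ _ (fun x => (x, y)) psi); last exact: cpsi.
  exact: (cvg_pair cvg_id (cvg_cst y)).
have dF x : is_derive x (1 : R) (fun x => c x * g y * phi (x, y))
   (tensor c g (x, y) * 'D_(e1 R) phi (x, y) + tensor c' g (x, y) * phi (x, y)).
  have h0 := is_derive1_mul (dc x) (is_derive_cst (g y) x (1 : R)).
  have h := is_derive1_mul h0 (is_derive_slice1 (hd1 (x, y))).
  apply: (is_derive_eq h); rewrite /tensor /cst /=; ring.
have cF x : {for x, continuous (fun x : R => tensor c g (x, y) * 'D_(e1 R) phi (x, y) + tensor c' g (x, y) * phi (x, y))}.
  apply: continuous_for_add; apply: continuous_for_mul.
  - by apply: continuous_for_mul; [exact: cc|exact: continuous_for_cst].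
  - exact: slice_cont hc1 x.
  - by apply: continuous_for_mul; [exact: cc'|exact: continuous_for_cst].
  - exact: slice_cont (test_function_continuous tphi) x.
rewrite integral_itv_bndo_bndc; last first.
  apply/measurable_EFinP/measurable_funTS; exact: continuous_measurable_fun.
have p0 : 0 < 2 * pi :> R by rewrite mulr_gt0 ?pi_gt0.
rewrite (integral_is_derive p0 (fun x _ => dF x) (fun x _ => cF x)).
by rewrite cper -[2 * pi]add0r hper subrr.
Qed.

(** Boundary terms vanish because the test function is zero near the ends. As [g] is differentiable
    only inside, the integral is first cut to [[-1 + e, 1 - e]]. *)
Lemma distr_partial2_tensor c g g' : continuous c ->
  (forall y : R, -1 < y < 1 -> is_derive y (1 : R) g (g' y)) ->
  C0 `]-1, 1[%classic true g -> C0 `]-1, 1[%classic true g' ->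
  distr_eq (distr_partial (e2 R) (distr_of (tensor c g))) (distr_of (tensor c g')).
Proof.
move=> cc dg cg cg' phi tphi.
have tphi2 := test_function_derive (or_intror erefl) tphi.
have [m1 [M1 b1]] := tensor_test cc cg tphi2.
have [m2 [M2 b2]] := tensor_test cc cg' tphi.
rewrite /distr_partial /distr_of; apply/eqP; rewrite eq_sym -addr_eq0 addrC; apply/eqP.
rewrite -RintegralD; last 3 first.
- exact: measurable_Omega.
- exact: bounded_integrable_Omega m1 b1.
- exact: bounded_integrable_Omega m2 b2.
apply: (@integral_slices_y _ _ (M1 + M2)).
- exact: measurable_funD m1 m2.
- by move=> z Oz; rewrite (le_trans (ler_normD _ _)) // lerD ?b1 ?b2.
move=> x xI; have [hC _ [d d0 hd]] := tphi; have [_ _ [d' d'0 hd']] := tphi2.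
have [_ hd2 _ hc2] := hC 1%N.
(* Halving puts [e] strictly below the margins of [phi] and of its derivative; [e <= 1 / 2] keeps
   the shortened interval nondegenerate. *)
pose e := Num.min (Num.min d d' / 2) 2^-1.
have dd0 : 0 < Num.min d d' by rewrite lt_min d0 d'0.
have e0 : 0 < e by rewrite lt_min divr_gt0 //= ?invr_gt0.
have e1' : e <= 2^-1 by rewrite ge_min lexx orbT.
have ed2 : e <= Num.min d d' / 2 by rewrite ge_min lexx.
have dd : Num.min d d' <= d by rewrite ge_min lexx.
have dd' : Num.min d d' <= d' by rewrite ge_min lexx orbT.
have ed : e < d by lra.
have ed' : e < d' by lra.
pose h (y : R) := tensor c g (x, y) * 'D_(e2 R) phi (x, y) + tensor c g' (x, y) * phi (x, y).
change (\int[mu]_(y in `](-1)%R, 1%R[) (h y)%:E = 0)%E.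
have -> : (\int[mu]_(y in `](-1)%R, 1%R[) (h y)%:E =
    \int[mu]_(y in `[(-1 + e)%R, (1 - e)%R]) (h y)%:E)%E.
  have -> : `[-1 + e, 1 - e]%classic = `]-1, 1[%classic `&` `[-1 + e, 1 - e]%classic.
    apply/seteqP; split => y /=; rewrite !in_itv /=; last by case.
    by move=> /andP[h1 h2]; split; [lra|apply/andP].
  rewrite integral_mkcondr; apply: eq_integral => y; rewrite inE /= in_itv /= => yI.
  rewrite patchE; case: ifPn => // yn.
  have hy : 1 - e < `|y|.
    rewrite ltNge ler_norml; apply/negP => /andP[h1 h2]; move/negP: yn; apply.
    by apply: mem_set; rewrite /= in_itv /= h2 andbT; lra.
  by rewrite /h hd ?hd' ?mulr0 ?addr0 //; lra.
have inI (y : R) : -1 + e <= y <= 1 - e -> -1 < y < 1 by move=> /andP[h1 h2]; lra.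
have slice_cont (psi : R * R -> R) : continuous psi -> continuous (fun y => psi (x, y)).
  move=> cpsi y; apply: (@continuous_comp _ _ _ (fun y => (x, y)) psi); last exact: cpsi.
  exact: (cvg_pair (cvg_cst x) cvg_id).
have dF y : -1 + e <= y <= 1 - e -> is_derive y (1 : R) (fun y => c x * g y * phi (x, y))
   (tensor c g (x, y) * 'D_(e2 R) phi (x, y) + tensor c g' (x, y) * phi (x, y)).
  move=> /inI yI; have h0 := is_derive1_mul (is_derive_cst (c x) y (1 : R)) (dg y yI).
  have h1 := is_derive1_mul h0 (is_derive_slice2 (hd2 (x, y))).
  apply: (is_derive_eq h1); rewrite /tensor /cst /=; ring.
have cF (y : R) : -1 + e <= y <= 1 - e -> {for y, continuous (fun y =>
    tensor c g (x, y) * 'D_(e2 R) phi (x, y) + tensor c g' (x, y) * phi (x, y))}.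
  move=> /inI yI; have yJ : `]-1, 1[%classic y by rewrite /= in_itv.
  apply: continuous_for_add; apply: continuous_for_mul.
  - by apply: continuous_for_mul; [exact: continuous_for_cst|exact: cg.1].
  - exact: slice_cont hc2 y.
  - by apply: continuous_for_mul; [exact: continuous_for_cst|exact: cg'.1].
  - exact: slice_cont (test_function_continuous tphi) y.
have le2 : -1 + e < 1 - e by lra.
rewrite (integral_is_derive le2 dF cF) !hd ?mulr0 ?subrr //.
- by rewrite ler0_norm; lra.
- by rewrite ger0_norm; lra.
Qed.

End test_functions.

(** * Sobolev regularity of separated functions, and cutoffs in [y] *)

Section sobolev_tensor.
Context {R : realType}.
Notation R2 := (measurableTypeR R * measurableTypeR R)%type.
Notation I1 := (`]-1, 1[%classic : set R).
Implicit Types (phi : R * R -> R) (v : R * R) (c g : R -> R).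

(** Cosine and sine are kept together so that differentiation only changes the two coefficients. *)
Definition trig n (A B x : R) : R := A * cos (n%:R * x) + B * sin (n%:R * x).

Lemma is_derive_trig n A B x :
  is_derive x (1 : R) (trig n A B) (trig n (n%:R * B) (- (n%:R * A)) x).
Proof.
have lin : is_derive x (1 : R) (fun x => n%:R * x) (n%:R : R).
  by have := is_derive1_affine n%:R 0 x; under eq_fun do rewrite addr0.
have hc := is_derive1_mul (is_derive_cst A x (1 : R)) (is_derive1_comp_rule lin (is_derive_cos _)).
have hs := is_derive1_mul (is_derive_cst B x (1 : R)) (is_derive1_comp_rule lin (is_derive_sin _)).
apply: (is_derive_eq (is_derive1_add hc hs)); rewrite /trig /cst; ring.
Qed.

Lemma trig_periodic n A B : periodic (trig n A B) (2 * pi).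
Proof.
move=> x; rewrite /trig mulrDr.
have -> : n%:R * (2 * pi) = pi *+ 2 *+ n :> R.
  by rewrite !mulr_natl.
by rewrite (periodicn (@cosD2pi R)) (periodicn (@sinD2pi R)).
Qed.

Lemma trig_continuous n A B : continuous (trig n A B).
Proof. by move=> x; exact: is_derive1_continuous (is_derive_trig n A B x). Qed.

Lemma trig_bounded n A B x : `|trig n A B x| <= `|A| + `|B|.
Proof.
rewrite (le_trans (ler_normD _ _)) // !normrM lerD // ler_piMr //.
- exact: cos_max.
- exact: sin_max.
Qed.

Lemma Ck_trig m n A B : Ck setT false m (trig n A B).
Proof.
elim: m A B => [|m IH] A B; have h0 : C0 setT false (trig n A B) by
  split=> // x _; exact: trig_continuous.
  by split.
apply: (CkS _ h0 (fun x _ => is_derive_trig n A B x) (IH _ _)); exact: openT.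
Qed.

Lemma L2_tensor c g : continuous c -> periodic c (2 * pi) -> C0 I1 true g ->
  L2 (tensor c g).
Proof.
move=> cc pc cg; have mt := measurable_tensor cc (C0W cg).
have [M hM] := tensor_bounded cc cg.
split=> //; first by move=> y _ x; rewrite /tensor /= pc.
have m2 : measurable_fun (Omega R : set R2) ((fun z => tensor c g z ^+ 2) : R2 -> measurableTypeR R).
  exact: measurable_funX.
have b2 z : Omega R z -> `|tensor c g z ^+ 2| <= M ^+ 2.
  by move=> Oz; rewrite normrX !expr2 ler_pM ?hM.
have /integrableP[_] := bounded_integrable_Omega m2 b2.
apply: le_lt_trans; rewrite le_eqVlt; apply/orP; left; apply/eqP.
by apply: eq_integral => z _; rewrite /= ger0_norm // sqr_ge0.
Qed.

Lemma distr_eq_trans (S T U : Defs.distribution R) :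
  distr_eq S T -> distr_eq T U -> distr_eq S U.
Proof. by move=> h1 h2 phi tphi; rewrite h1 // h2. Qed.

Lemma distr_partial_eq v (S T : Defs.distribution R) : v = e1 R \/ v = e2 R ->
  distr_eq S T -> distr_eq (distr_partial v S) (distr_partial v T).
Proof.
move=> hv ST phi tphi; rewrite /distr_partial ST //.
exact: test_function_derive.
Qed.

Lemma distr_partial1_trig n A B g : C0 I1 true g ->
  distr_eq (distr_partial (e1 R) (distr_of (tensor (trig n A B) g)))
           (distr_of (tensor (trig n (n%:R * B) (- (n%:R * A))) g)).
Proof.
move=> cg; apply: distr_partial1_tensor => //.
- by move=> x; exact: is_derive_trig.
- exact: trig_continuous.
- by have := trig_periodic n A B 0; rewrite add0r.
Qed.

(** Every weak derivative is again a tensor: derivatives in [y] act on [g], those in [x] on the two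
    trigonometric coefficients. *)
Lemma sobolev_oo_tensor n A B g : (forall m, Ck I1 true m g) ->
  sobolev_oo (tensor (trig n A B) g).
Proof.
move=> hg N; split.
  by apply: L2_tensor; [exact: trig_continuous|exact: trig_periodic|exact: Ck_C0 (hg 0%N)].
move=> a b _.
have [gb hgb wb] : exists2 gb, (forall m, Ck I1 true m gb) &
    distr_eq (iter b (distr_partial (e2 R)) (distr_of (tensor (trig n A B) g)))
             (distr_of (tensor (trig n A B) gb)).
  elim: b => [|b [gb hgb wb]]; first by exists g.
  exists gb^`()%classic; first by move=> m; exact: Ck_derive (hgb m.+1).
  apply: distr_eq_trans (distr_partial_eq (or_intror erefl) wb) _.
  apply: distr_partial2_tensor.
  - exact: trig_continuous.
  - by move=> y yI; apply: Ck_is_derive (hgb 1%N) _; rewrite /= in_itv.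
  - exact: Ck_C0 (hgb 0%N).
  - exact: Ck_C0 (Ck_derive (hgb 1%N)).
have [A' [B' wa]] : exists A' B', distr_eq
    (iter a (distr_partial (e1 R)) (iter b (distr_partial (e2 R)) (distr_of (tensor (trig n A B) g))))
    (distr_of (tensor (trig n A' B') gb)).
  elim: a => [|a [A' [B' wa]]]; first by exists A, B.
  exists (n%:R * B'), (- (n%:R * A')).
  apply: distr_eq_trans (distr_partial_eq (or_introl erefl) wa) _.
  apply: distr_partial1_trig; exact: Ck_C0 (hgb 0%N).
exists (tensor (trig n A' B') gb) => //.
by apply: L2_tensor; [exact: trig_continuous|exact: trig_periodic|exact: Ck_C0 (hgb 0%N)].
Qed.

Lemma is_derive_tensor1 c g (z : R * R) d : is_derive z.1 (1 : R) c d ->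
  is_derive z (e1 R) (tensor c g) (d * g z.2).
Proof.
case: z => x y /= dc; apply: slice1_is_derive.
have := is_derive1_mul dc (is_derive_cst (g y) x (1 : R)).
by rewrite mulr0 addr0.
Qed.

Lemma is_derive_tensor2 c g (z : R * R) d : is_derive z.2 (1 : R) g d ->
  is_derive z (e2 R) (tensor c g) (c z.1 * d).
Proof.
case: z => x y /= dg; apply: slice2_is_derive.
have := is_derive1_mul (is_derive_cst (c x) y (1 : R)) dg.
by rewrite mul0r add0r.
Qed.

Lemma class_C_tensor m c g : Ck setT false m c -> Ck setT false m g ->
  class_C m (tensor c g).
Proof.
elim: m c g => [|m IH] c g hc hg.
  have [cc _] := Ck_C0 hc; have [cg _] := Ck_C0 hg.
  move=> z /=.
  have h1 : (fun z : R * R => c z.1) z @[z --> z] --> c z.1.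
    by apply: (@continuous_comp _ _ _ fst c); [exact: cvg_fst|exact: cc].
  have h2 : (fun z : R * R => g z.2) z @[z --> z] --> g z.2.
    by apply: (@continuous_comp _ _ _ snd g); [exact: cvg_snd|exact: cg].
  exact: cvgM h1 h2.
have dc x := Ck_is_derive (x := x) hc I; have dg y := Ck_is_derive (x := y) hg I.
split.
- by move=> z; have [] := is_derive_tensor1 g (dc z.1).
- by move=> z; have [] := is_derive_tensor2 c (dg z.2).
- rewrite (_ : (fun z => _) = tensor c^`()%classic g).
    by apply: IH; [exact: Ck_derive hc|exact: Ck_pred hg].
  by apply/funext => z; have [_ ->] := is_derive_tensor1 g (dc z.1).
- rewrite (_ : (fun z => _) = tensor c g^`()%classic).
    by apply: IH; [exact: Ck_pred hc|exact: Ck_derive hg].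
  by apply/funext => z; have [_ ->] := is_derive_tensor2 c (dg z.2).
Qed.

(** [g] is smooth only inside. The open sets []-1, 1[] and [V] cover the line, and on [V] the
    product is identically zero. *)
Lemma Ck_cutoff m g (chi : R -> R) (d : R) : 0 < d ->
  (forall y : R, 1 - d < `|y| -> chi y = 0) -> Ck I1 false m g ->
  Ck setT false m chi -> Ck setT false m (fun y => g y * chi y).
Proof.
move=> d0; pose V := [set y : R | 1 - d < `|y|].
have oV : open V.
  apply: (@open_comp _ _ (@Num.norm R R) [set y | 1 - d < y]); last exact: open_gt.
  by move=> x _; exact: norm_continuous.
have oI : open I1 by exact: itv_open.
have IV y : I1 y \/ V y.
  have [yI|yI] := boolP (-1 < y < 1); first by left; rewrite /= in_itv.
  right; rewrite /V /= (@lt_le_trans _ _ 1) //; first by rewrite ltrBlDr ltrDl.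
  by rewrite leNgt ltr_norml.
elim: m g chi => [|m IH] g chi chi0 hg hchi.
  split=> //; split=> // y _; have [yI|yV] := IV y.
    by apply: continuous_for_mul; [exact: (Ck_C0 hg).1|exact: (Ck_C0 hchi).1].
  have h : C0 V false (fun=> 0 : R) by split=> // x _; exact: cvg_cst.
  have hV : forall x, V x -> 0 = g x * chi x by move=> x /chi0 ->; rewrite mulr0.
  exact: (C0_eq oV hV h).1.
(* [chi'] vanishes on [V] as well, so the induction hypothesis also covers [g chi']. *)
have dchi0 y : V y -> chi^`()%classic y = 0.
  move=> yV; apply: is_derive1_derive1.
  by apply: (@is_derive1_eq_on _ V (fun=> 0)) => // x /chi0.
have D y : is_derive y (1 : R) (fun y => g y * chi y)
    (g^`()%classic y * chi y + g y * chi^`()%classic y).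
  have [yI|yV] := IV y.
    exact: is_derive1_mul (Ck_is_derive hg yI) (Ck_is_derive hchi I).
  rewrite dchi0 // (chi0 y yV) !mulr0 addr0.
  by apply: (@is_derive1_eq_on _ V (fun=> 0)) => // x /chi0 ->; rewrite mulr0.
have h0 : C0 setT false (fun y => g y * chi y).
  by split=> // x _; exact: is_derive1_continuous (D x).
have h1 := IH _ _ chi0 (Ck_derive hg) (Ck_pred hchi).
have h2 := IH _ _ dchi0 (Ck_pred hg) (Ck_derive hchi).
exact: (CkS openT h0 (fun x _ => D x) (CkD openT h1 h2)).
Qed.

(** It vanishes within [1 / n] of either end and equals 1 at distance at least [2 / n] from both. *)
Definition cutoff (n : nat) (y : R) : R :=
  step (n%:R * (1 - y)) * step (n%:R * (1 + y)).

Definition cutoff' (n : nat) (y : R) : R :=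
  - n%:R * step^`()%classic (n%:R * (1 - y)) * step (n%:R * (1 + y)) +
  step (n%:R * (1 - y)) * (n%:R * step^`()%classic (n%:R * (1 + y))).

Let Ck_step_affine m (p q : R) : Ck setT false m (fun y => step (p * y + q)).
Proof. exact: Ck_affine (Ck_step m). Qed.

Lemma Ck_cutoff_fun m n : Ck setT false m (cutoff n).
Proof.
apply: CkM; first exact: openT.
- apply: Ck_eq (Ck_step_affine m (- n%:R) n%:R) => [|x _]; first exact: openT.
  by congr step; ring.
- apply: Ck_eq (Ck_step_affine m n%:R n%:R) => [|x _]; first exact: openT.
  by congr step; ring.
Qed.

Lemma is_derive_cutoff n y : is_derive y (1 : R) (cutoff n) (cutoff' n y).
Proof.
have ds t : is_derive t (1 : R) step (step^`()%classic t) :=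
  Ck_is_derive (Ck_step 1) I.
have h1 : is_derive y (1 : R) (fun y => n%:R * (1 - y)) (- n%:R).
  apply: (is_derive1_eq_on openT) (is_derive1_affine (- n%:R) n%:R y) => // x _.
  by ring.
have h2 : is_derive y (1 : R) (fun y => n%:R * (1 + y)) (n%:R).
  apply: (is_derive1_eq_on openT) (is_derive1_affine n%:R n%:R y) => // x _.
  by ring.
have := is_derive1_mul (is_derive1_comp_rule h1 (ds _)) (is_derive1_comp_rule h2 (ds _)).
rewrite (_ : _ + _ = cutoff' n y) //.
rewrite /cutoff'; move: (step _) (step _) (_^`()%classic _) (_^`()%classic _) => s1 s2 s3 s4.
ring.
Qed.

Lemma cutoff_eq0 n (y : R) : (0 < n)%N -> 1 - n%:R^-1 < `|y| -> cutoff n y = 0.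
Proof.
move=> n0; rewrite ltrBlDr -ltrBlDl => hy; rewrite /cutoff.
have n0' : 0 < n%:R :> R by rewrite ltr0n.
have [y0|y0] := leP 0 y.
  rewrite [step (_ * (1 - y))]step_eq0 ?mul0r //.
  by rewrite mulrC -ler_pdivlMr // mul1r; rewrite ger0_norm // in hy; exact: ltW.
rewrite [step (_ * (1 + y))]step_eq0 ?mulr0 //.
by rewrite mulrC -ler_pdivlMr // mul1r; rewrite ltr0_norm // opprK in hy; exact: ltW.
Qed.

Lemma step'_eq0 (t : R) : 2 < t -> step^`()%classic t = 0.
Proof.
move=> t2; apply: is_derive1_derive1.
have o : open [set t : R | 2 < t] by exact: open_gt.
by apply: (@is_derive1_eq_on _ [set t | 2 < t] (fun=> 1)) => // x /ltW /step_eq1.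
Qed.

Lemma step'_eq0_left (t : R) : t < 1 -> step^`()%classic t = 0.
Proof.
move=> t1; apply: is_derive1_derive1.
have o : open [set t : R | t < 1] by exact: open_lt.
by apply: (@is_derive1_eq_on _ [set t | t < 1] (fun=> 0)) => // x /ltW /step_eq0.
Qed.

(** [step'] vanishes off [[1, 2]], where it is bounded by compactness; the factor 2 is the largest
    [t]. *)
Lemma step'_bound : exists2 T : R, 0 <= T & forall t : R, `|t * step^`()%classic t| <= T.
Proof.
have c' (x : R) : {for x, continuous (step^`()%classic : R -> R)}.
  exact: (Ck_C0 (Ck_derive (Ck_step 1))).1.
have l12 : (1 : R) <= 2 by lra.
have [B B0 hB] := continuous_bounded_itv l12 (fun x _ => c' x).
exists (2 * B) => [|t]; first by rewrite mulr_ge0.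
have [t1|t1] := ltP t 1; first by rewrite step'_eq0_left // mulr0 normr0 mulr_ge0.
have [t2|t2] := ltP 2 t; first by rewrite step'_eq0 // mulr0 normr0 mulr_ge0.
have tn : `|t| <= 2 by rewrite ger0_norm //; lra.
have t12 : 1 <= t <= 2 by rewrite t1.
by rewrite normrM ler_pM // hB.
Qed.

End sobolev_tensor.

(** * Membership in H^1_0 *)

Section sobolev10_tensor.
Context {R : realType}.
Notation R2 := (measurableTypeR R * measurableTypeR R)%type.
Notation I1 := (`]-1, 1[%classic : set R).

Lemma cutoff_itv n (y : R) : 0 <= cutoff n y <= 1.
Proof. by rewrite mulr_ge0 ?step_ge0 //= mulr_ile1 ?step_ge0 ?step_le1. Qed.

Lemma cutoff_near1 (y : R) : -1 < y < 1 ->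
  \forall n \near \oo, cutoff n y = 1 /\ cutoff' n y = 0.
Proof.
move=> /andP[y1 y2].
have h1 : 0 < 1 - y by rewrite subr_gt0.
have h2 : 0 < 1 + y by rewrite -ltrBlDl sub0r.
pose K := 2 / (1 - y) + 2 / (1 + y).
near=> n.
have Kn : K < n%:R.
  have Nn : ((Num.truncn K).+1 <= n)%N by near: n; exact: nbhs_infty_ge.
  by apply: (@lt_le_trans _ _ (Num.truncn K).+1%:R); [exact: truncnS_gt|rewrite ler_nat].
have k1 : 2 < n%:R * (1 - y).
  rewrite -ltr_pdivrMr //; apply: le_lt_trans Kn.
  by rewrite lerDl divr_ge0 // ltW.
have k2 : 2 < n%:R * (1 + y).
  rewrite -ltr_pdivrMr //; apply: le_lt_trans Kn.
  by rewrite lerDr divr_ge0 // ltW.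
rewrite /cutoff /cutoff' !step_eq1 ?(ltW k1) ?(ltW k2) // !step'_eq0 //.
by split; ring.
Unshelve. all: by end_near. Qed.

(* The factor [n] in the derivative of [cutoff n] is absorbed by the distance
   to the boundary: [phi] vanishes linearly there and [t step' t] is bounded. *)
Lemma cutoff'_bound (phi p : R -> R) P : continuous phi -> phi (-1) = 0 -> phi 1 = 0 ->
  (forall y : R, -1 < y < 1 -> is_derive y (1 : R) phi (p y)) ->
  (forall y : R, -1 < y < 1 -> `|p y| <= P) ->
  exists M, forall n y, -1 < y < 1 -> `|phi y * cutoff' n y| <= M.
Proof.
move=> cphi p1 p2 dphi bp; have [T T0 hT] := @step'_bound R.
have P0 : 0 <= P by apply: le_trans (bp 0 _); rewrite // ltrN10 ltr01.
exists (P * T + P * T) => n y /andP[y1 y2].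
have b1 : `|phi y| <= P * (1 - y).
  have dt x : y < x < 1 -> is_derive x (1 : R) phi (p x).
    by move=> /andP[x1 x2]; apply: dphi; rewrite x2 (lt_trans y1 x1).
  have [x /andP[x1 x2]] := MVT_continuous y2 dt (fun x _ => cphi x).
  rewrite p2 sub0r => E; rewrite -normrN E normrM (ger0_norm (x := 1 - y)) ?subr_ge0 ?(ltW y2) //.
  by rewrite ler_wpM2r ?subr_ge0 ?(ltW y2) // bp // x2 (lt_trans y1 x1).
have b2 : `|phi y| <= P * (1 + y).
  have dt x : -1 < x < y -> is_derive x (1 : R) phi (p x).
    by move=> /andP[x1 x2]; apply: dphi; rewrite x1 (lt_trans x2 y2).
  have [x /andP[x1 x2]] := MVT_continuous y1 dt (fun x _ => cphi x).
  have y0 : 0 <= 1 + y by lra.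
  rewrite p1 subr0 opprK [y + 1]addrC => ->; rewrite normrM (ger0_norm y0).
  by rewrite ler_wpM2r // bp // x1 (lt_trans x2 y2).
(* With [t = n d], the product [d * n * step' (n d)] is [t step' t], bounded by [T] uniformly in
   [n]. Each end contributes one [P * T]. *)
have main (d sigma : R) : 0 <= d -> `|phi y| <= P * d -> 0 <= sigma <= 1 ->
    `|phi y| * (n%:R * `|step^`()%classic (n%:R * d)|) * sigma <= P * T.
  move=> d0 bd /andP[s0 s1].
  have h0 : 0 <= n%:R * `|step^`()%classic (n%:R * d)| by rewrite mulr_ge0.
  apply: (@le_trans _ _ (P * d * (n%:R * `|step^`()%classic (n%:R * d)|))).
    by apply: le_trans (ler_piMr _ s1) _; rewrite ?mulr_ge0 // ler_wpM2r.
  rewrite -mulrA ler_wpM2l // (le_trans _ (hT (n%:R * d))) //.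
  by rewrite normrM (ger0_norm (x := n%:R * d)) ?mulr_ge0 // mulrCA mulrA.
have i1 : 0 <= step (n%:R * (1 + y)) <= 1 by rewrite step_ge0 step_le1.
have i2 : 0 <= step (n%:R * (1 - y)) <= 1 by rewrite step_ge0 step_le1.
have d1 : 0 <= 1 - y by lra.
have d2 : 0 <= 1 + y by lra.
rewrite /cutoff' mulrDr (le_trans (ler_normD _ _)) // lerD //.
  apply: le_trans (main _ _ d1 b1 i1); rewrite normrM [X in _ * X]normrM (ger0_norm (step_ge0 _)).
  by rewrite [X in _ * (X * _)]normrM normrN normr_nat !mulrA.
apply: le_trans (main _ _ d2 b2 i2); rewrite normrM [X in _ * X]normrM (ger0_norm (step_ge0 _)).
by rewrite [X in _ * (_ * X)]normrM normr_nat [step _ * _]mulrC !mulrA.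
Qed.

(** The approximants are the tensors cut off in [y]. Their squared error is bounded uniformly and,
    at each fixed point, eventually zero, so its integral tends to 0 by dominated convergence. *)
Lemma sobolev10_tensor n A B (phi p : R -> R) : continuous phi ->
  phi (-1) = 0 -> phi 1 = 0 ->
  (forall y : R, -1 < y < 1 -> is_derive y (1 : R) phi (p y)) ->
  (forall m, Ck I1 true m phi) -> C0 I1 true p ->
  sobolev10 (tensor (trig n A B) phi).
Proof.
move=> cphi p1 p2 dphi hphi hp.
have oI : open I1 by exact: itv_open.
have IE (y : R) : I1 y <-> -1 < y < 1 by rewrite /= in_itv.
have hphi0 := Ck_C0 (hphi 0%N).
set A' := n%:R * B; set B' := - (n%:R * A).
have L2t (D E : R) (g : R -> R) : C0 I1 true g -> L2 (tensor (trig n D E) g).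
  by apply: L2_tensor; [exact: trig_continuous|exact: trig_periodic].
split; first exact: L2t.
exists (tensor (trig n A' B') phi), (tensor (trig n A B) p); split.
- exact: L2t.
- exact: distr_partial1_trig.
- exact: L2t.
- by apply: distr_partial2_tensor => //; exact: trig_continuous.
move=> e e0.
(* The shift keeps the margin [1 / (j + 1)] meaningful at [j = 0]. *)
pose chi j := cutoff (R := R) j.+1.
have cchi m j : Ck setT false m (chi j) by exact: Ck_cutoff_fun.
have dchi j : (chi j)^`()%classic = cutoff' j.+1.
  by apply/funext => y; apply: is_derive1_derive1; exact: is_derive_cutoff.
pose g j y := phi y * chi j y.
pose r j y := phi y * (1 - chi j y).
(* The error [p - (phi chi)'] in the [y]-derivative; its second term is the one that needs the
   linear vanishing of [phi]. *)
pose s j y := p y * (1 - chi j y) - phi y * cutoff' j.+1 y.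
have hg j m : Ck setT false m (g j).
  apply: (@Ck_cutoff _ m phi (chi j) (j.+1%:R^-1)) => //.
  - by move=> y; exact: cutoff_eq0.
  - elim: m (phi) (hphi m) => [|m IH] f [[h0 _] h]; first by split.
    by split=> //; split=> //; [exact: h.1|exact: IH h.2].
pose test j := tensor (trig n A B) (g j).
have htest j : test_function (test j).
  split.
  - by move=> m; apply: class_C_tensor; [exact: Ck_trig|exact: hg].
  - by move=> y x; rewrite /test /tensor /= trig_periodic.
  - exists (j.+1%:R^-1); first by [].
    by move=> x y xy; rewrite /test /tensor /g /= /chi cutoff_eq0 // !mulr0.
have test1 j z : 'D_(e1 R) (test j) z = trig n A' B' z.1 * g j z.2.
  by have [_ ->] := is_derive_tensor1 (g j) (is_derive_trig n A B z.1).
have test2 j z : Omega R z -> 'D_(e2 R) (test j) z =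
    trig n A B z.1 * (p z.2 * chi j z.2 + phi z.2 * cutoff' j.+1 z.2).
  case: z => x y [_ /= yI]; rewrite in_itv /= in yI.
  have := is_derive1_mul (dphi y yI) (is_derive_cutoff j.+1 y).
  by move=> /(is_derive_tensor2 (trig n A B) (z := (x, y)))[_ ->].
pose F j z := tensor (trig n A B) (r j) z ^+ 2 + tensor (trig n A' B') (r j) z ^+ 2
  + tensor (trig n A B) (s j) z ^+ 2.
have FE j z : Omega R z -> (tensor (trig n A B) phi z - test j z) ^+ 2 +
    (tensor (trig n A' B') phi z - 'D_(e1 R) (test j) z) ^+ 2 +
    (tensor (trig n A B) p z - 'D_(e2 R) (test j) z) ^+ 2 = F j z.
  move=> Oz; rewrite test1 test2 // /F /test /tensor /r /s /g.
  congr (_ ^+ 2 + _ ^+ 2 + _ ^+ 2); ring.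
have c0chi j : C0 I1 false (fun y => 1 - chi j y).
  split=> // y _; apply: continuous_for_sub; first exact: continuous_for_cst.
  exact: (Ck_C0 (cchi 0%N j)).1.
have c0r j : C0 I1 false (r j) by apply: C0M; [exact: C0W hphi0|exact: c0chi].
have c0s j : C0 I1 false (s j).
  split=> // y yI; apply: continuous_for_sub; apply: continuous_for_mul.
  - exact: hp.1.
  - exact: (c0chi j).1.
  - exact: cphi.
  - by rewrite -dchi; exact: (Ck_C0 (Ck_derive (cchi 1%N j))).1.
have [P0 bP0] := hphi0.2 isT; have [P1 bP1] := hp.2 isT.
have bP1' (y : R) : -1 < y < 1 -> `|p y| <= P1 by move=> /IE; exact: bP1.
have [M bM] := cutoff'_bound cphi p1 p2 dphi bP1'.
have chi1 j y : `|1 - chi j y| <= 1.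
  have /andP[h0 h1] := cutoff_itv j.+1 y.
  by rewrite ger0_norm ?subr_ge0 // gerBl.
have br j y : I1 y -> `|r j y| <= P0.
  move=> yI; rewrite /r normrM (le_trans (ler_piMr _ (chi1 j y))) //; exact: bP0.
have bs j y : I1 y -> `|s j y| <= P1 + M.
  move=> yI; rewrite /s (le_trans (ler_normB _ _)) // lerD //.
    by rewrite normrM (le_trans (ler_piMr _ (chi1 j y))) //; exact: bP1.
  by apply: bM; apply/IE.
have bt (D E : R) (u : R -> R) (Q : R) z : Omega R z -> (forall y, I1 y -> `|u y| <= Q) ->
    tensor (trig n D E) u z ^+ 2 <= ((`|D| + `|E|) * Q) ^+ 2.
  case: z => x y [_ yI] bu; rewrite -real_normK ?num_real // !expr2.
  by rewrite ler_pM ?normr_ge0 // /tensor normrM ler_pM ?trig_bounded ?bu.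
have mF j : measurable_fun (Omega R : set R2) (F j : R2 -> measurableTypeR R).
  have mt (D E : R) (u : R -> R) : C0 I1 false u -> measurable_fun (Omega R : set R2)
      ((fun z => tensor (trig n D E) u z ^+ 2) : R2 -> measurableTypeR R).
    by move=> cu; apply: measurable_funX; exact: measurable_tensor (@trig_continuous R n D E) cu.
  exact: measurable_funD (measurable_funD (mt A B _ (c0r j)) (mt A' B' _ (c0r j))) (mt A B _ (c0s j)).
have F0 j z : 0 <= F j z by rewrite !addr_ge0 // sqr_ge0.
set MM := ((`|A| + `|B|) * P0) ^+ 2 + ((`|A'| + `|B'|) * P0) ^+ 2 + ((`|A| + `|B|) * (P1 + M)) ^+ 2.
have bF j z : Omega R z -> `|F j z| <= MM.
  move=> Oz; rewrite ger0_norm //; apply: lerD; first apply: lerD.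
  - exact: bt Oz (br j).
  - exact: bt Oz (br j).
  - exact: bt Oz (bs j).
have cF z : Omega R z -> F j z @[j --> \oo] --> (0 : R).
  case: z => x y [_ /IE yI]; apply: cvg_near_cst.
  have h : \forall j \near \oo, cutoff j.+1 y = 1 /\ cutoff' j.+1 y = 0.
    have [N _ hN] := cutoff_near1 yI.
    by exists N => [//|j Nj]; exact: (hN j.+1 (leqW Nj)).
  apply: filterS h => j [h1 h2].
  by rewrite /F /tensor /r /s /chi /= h1 h2 subrr !mulr0 subrr mulr0 expr0n /= !addr0.
have cvI := integral_Omega_cvg0 mF bF cF.
have iF j := bounded_integrable_Omega (mF j) (bF j).
have cvR : \int[area R]_(z in Omega R) F j z @[j --> \oo] --> (0 : R).
  by apply: fine_cvg; exact: cvI.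
have /cvgrPdist_lt /(_ e e0) [N _ /(_ N (leqnn N)) hN] := cvR.
exists (test N) => //.
rewrite (_ : (\int[_]_(_ in _) _)%E = (\int[area R]_(z in Omega R) F N z)%:E); last first.
  rewrite /Rintegral fineK; last first.
    by apply: integrable_fin_num => //; [exact: measurable_Omega|exact: iF].
  by apply: eq_integral => z; rewrite inE => Oz; rewrite FE.
by move: hN; rewrite lte_fin /= sub0r normrN; apply: le_lt_trans; exact: ler_norm.
Qed.

End sobolev10_tensor.

(** * The eigenfunctions *)

Section eigenfunction.
Context {R : realType}.
Notation mu := (@lebesgue_measure R).
Notation R2 := (measurableTypeR R * measurableTypeR R)%type.
Notation I1 := (`]-1, 1[%classic : set R).

Lemma W_oo_oo_Ck (f : R -> R) : W_oo_oo f -> forall m, Ck I1 true m f.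
Proof.
have oI : open I1 by exact: itv_open.
move=> hf m; elim: m f hf => [|m IH] f hf; have [h1 [M hM]] := hf 0%N;
  have df x : I1 x -> is_derive x (1 : R) f (f^`()%classic x) by
    rewrite /= in_itv => /h1 /derivable_is_derive.
  split=> //; split=> [x /df /is_derive1_continuous //|_].
  by exists M => x; rewrite /= in_itv; exact: hM.
have h0 : C0 I1 true f.
  split=> [x /df /is_derive1_continuous //|_].
  by exists M => x; rewrite /= in_itv; exact: hM.
have hf' : W_oo_oo f^`()%classic by move=> n; have := hf n.+1; rewrite derive1Sn.
exact: (CkS oI h0 df (IH _ hf')).
Qed.

(** Bootstrap: [phi' = p] and [p' = k (1 - m a) phi] raise the order of both by one. Boundedness at
    order 0 comes from continuity on the closed interval. *)
Lemma Ck_shot (a : R -> R) k m phi p : (forall j, Ck I1 true j a) ->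
  shot a k m phi p -> forall j, Ck I1 true j phi /\ Ck I1 true j p.
Proof.
move=> ha [cphi cp _ dphi dp].
have oI : open I1 by exact: itv_open.
have N11 : (-1 : R) <= 1 by rewrite (le_trans (lerN10 R) ler01).
have c0 (f : R -> R) : continuous f -> C0 I1 true f.
  move=> cf; split=> [x _|_]; first exact: cf.
  have [B _ hB] := continuous_bounded_itv N11 (fun x _ => cf x).
  by exists B => x; rewrite /= in_itv => /andP[/ltW x1 /ltW x2]; apply: hB; rewrite x1.
elim=> [|j [IH1 IH2]]; first by split; split=> //; exact: c0.
have dphiI x : I1 x -> is_derive x (1 : R) phi (p x) by rewrite /= in_itv; exact: dphi.
split; first exact: (CkS oI (c0 _ cphi) dphiI IH2).
have dpI x : I1 x -> is_derive x (1 : R) p ((k + (- (k * m)) * a x) * phi x).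
  rewrite /= in_itv => /dp h; apply: (is_derive_eq h); ring.
have hc c := Ck_cst true j c oI.
exact: (CkS oI (c0 _ cp) dpI (CkM oI (CkD oI (hc k) (CkM oI (hc _) (ha j))) IH1)).
Qed.

Variables (rho : R -> R) (n : nat) (m : R) (phi p : R -> R).
Let a := derive1 rho.
Hypothesis n0 : (0 < n)%N.
Hypothesis m0 : 0 < m.
Hypothesis ha : forall j, Ck I1 true j a.
Hypothesis hs : shot a (n%:R ^+ 2) m phi p.
Hypothesis phi_gt0 : forall t : R, -1 < t < 1 -> 0 < phi t.
Hypothesis phi1 : phi 1 = 0.

Let wt y := n%:R * m * a y * phi y.
Let w := tensor (trig n 1 0) wt.

Let oI : open I1. Proof. exact: itv_open. Qed.

Let hphi j : Ck I1 true j phi. Proof. by have [] := Ck_shot ha hs j. Qed.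
Let hp j : Ck I1 true j p. Proof. by have [] := Ck_shot ha hs j. Qed.

Let hwt j : Ck I1 true j wt.
Proof. by apply: CkM => //; apply: CkM => //; exact: Ck_cst. Qed.

Lemma eigenfunction_sobolev : sobolev_oo w.
Proof. exact: sobolev_oo_tensor. Qed.

Let L2t A B g : C0 I1 true g -> L2 (tensor (trig n A B) g).
Proof. by apply: L2_tensor; [exact: trig_continuous|exact: trig_periodic]. Qed.

(** With [psi = sin (n x) phi], both the Laplacian of [psi] and the [x]-derivative of [w] equal
    [- n^2 m a phi sin (n x)], and [a] times the [x]-derivative of [psi] is
    [n a phi cos (n x) = w / m]. *)
Lemma eigenfunction_graph : L_graph rho w (fun z => m^-1 * w z).
Proof.
have [cphi cp [i1 i2] dphi dp] := hs.
split; first by apply: L2t; exact: Ck_C0 (hwt 0%N).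
  rewrite (_ : (fun z => _) = tensor (trig n m^-1 0) wt).
    by apply: L2t; exact: Ck_C0 (hwt 0%N).
  by apply/funext => z; rewrite /w /tensor /trig; ring.
(* The coefficients of [q] are left in the form in which [distr_partial1_trig] produces them. *)
exists (tensor (trig n 0 1) phi), (tensor (trig n (n%:R * 1) (- (n%:R * 0))) phi).
have c0phi := Ck_C0 (hphi 0%N); have c0p := Ck_C0 (hp 0%N).
have c0q : C0 I1 true (fun t => n%:R ^+ 2 * (1 - m * a t) * phi t).
  have : Ck I1 true 0 (fun t => (n%:R ^+ 2 + (- (n%:R ^+ 2 * m)) * a t) * phi t).
    apply: CkM => //; apply: CkD => //; first exact: Ck_cst.
    by apply: CkM => //; exact: Ck_cst.
  move=> /Ck_C0; apply: C0_eq => // t _; ring.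
split.
- split; first exact: sobolev10_tensor.
  move=> f tf; rewrite /distr_laplacian.
  have h11 := distr_eq_trans
    (distr_partial_eq (or_introl erefl) (distr_partial1_trig n 0 1 c0phi))
    (distr_partial1_trig n _ _ c0phi).
  have h22 := distr_eq_trans
    (distr_partial_eq (or_intror erefl)
      (distr_partial2_tensor (@trig_continuous R n 0 1) dphi c0phi c0p))
    (distr_partial2_tensor (@trig_continuous R n 0 1) dp c0p c0q).
  rewrite h11 // h22 // (distr_partial1_trig n 1 0 (Ck_C0 (hwt 0%N))) //.
  rewrite /distr_of -RintegralD; last 3 first.
  - exact: measurable_Omega.
  - by apply: tensor_test_integrable => //; exact: trig_continuous.
  - by apply: tensor_test_integrable => //; exact: trig_continuous.
  by apply: eq_Rintegral => z _; rewrite /tensor /trig /wt; ring.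
- exact: L2t.
- exact: distr_partial1_trig.
- apply: aeW => z _; rewrite /w /tensor /trig /wt -/a.
  by field; rewrite gt_eqF.
Qed.

(** On the box [[0, pi / (2 n)[] times an interval where [a] is positive, the cosine, [a] and [phi]
    are all positive, so [w] is nonzero on a set of positive area. *)
Lemma eigenfunction_neq0 : (exists2 t, -1 < t < 1 & 0 < a t) ->
  ~ ae_Omega (fun z => w z = 0).
Proof.
have ca (t : R) : -1 < t < 1 -> {for t, continuous a}.
  by move=> tI; apply: (Ck_C0 (ha 0%N)).1; rewrite /= in_itv.
move=> [t tI at0].
have at2 : a t / 2 < a t by rewrite ltr_pdivrMr // ltr_pMr // ltr1n.
have [c [d [c1 cd d1 hcd]]] := oscillation_interval ca (ex_intro2 _ _ t tI at2).
have nR : 0 < n%:R :> R by rewrite ltr0n.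
pose x1 := pi / 2 / n%:R : R.
have x10 : 0 < x1 by rewrite !divr_gt0 ?pi_gt0.
pose Q : set R2 := `[0, x1[ `*` `[c, d].
have mQ : measurable Q by exact: (measurableX (measurable_itv _) (measurable_itv _)).
have x1n : x1 * n%:R = pi / 2 by rewrite /x1 divfK // gt_eqF.
have n1 : 1 <= n%:R :> R by rewrite ler1n.
have pi0 := @pi_gt0 R.
have x1pi : x1 < 2 * pi by nra.
have hQ z : Q z -> Omega R z /\ w z != 0.
  case: z => x y [] /=; rewrite !in_itv /= => /andP[x0 xx1] /andP[yc yd].
  have yI : -1 < y < 1 by rewrite (lt_le_trans c1 yc) (le_lt_trans yd d1).
  split; first by apply/OmegaE; rewrite x0 (lt_trans xx1 x1pi).
  rewrite /w /tensor /trig /= mul1r mul0r addr0 gt_eqF // mulr_gt0 //.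
    have nx : n%:R * x < pi / 2 by rewrite -x1n mulrC ltr_pM2r.
    have nx0 : 0 <= n%:R * x by rewrite mulr_ge0.
    by apply: cos_gt0_pihalf; rewrite nx andbT; lra.
  have ay : 0 < a y by apply: lt_le_trans (hcd y _); rewrite ?divr_gt0 ?yc.
  by rewrite /wt !mulr_gt0 // phi_gt0.
move=> hae.
have nQ : (area R).-negligible Q.
  apply: negligibleS hae => z Qz /= hz; have [Oz /eqP] := hQ z Qz.
  by apply; exact: hz.
have : area R Q = 0%E by exact: (negligibleP _ mQ).1 nQ.
rewrite /Q product_measure1E; [|exact: measurable_itv|exact: measurable_itv].
rewrite [X in (X * _)%E](_ : _ = mu [set` `[0, x1[]) // lebesgue_measure_itv /=.
rewrite [X in (_ * X)%E](_ : _ = mu [set` `[c, d]]) // lebesgue_measure_itv /=.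
rewrite !lte_fin x10 cd -!EFinB -EFinM subr0 => -[] /eqP.
by rewrite mulf_eq0 subr_eq0 !gt_eqF.
Qed.

End eigenfunction.

Unset Implicit Arguments.
Set Strict Implicit.

Theorem theorem2p3 (R : realType) (rho : R -> R)
    (rho_derivable : forall y : R, -1 < y < 1 -> derivable rho y 1)
    (rho'_bounded : W_oo_oo (derive1 rho))
    (rho'_sup : 0 < sup [set derive1 rho y | y in `]-1, 1[%classic]) :
  exists lambda : nat -> R,
    [/\ forall k, (1 <= k)%N -> 0 < lambda k /\ L_eigenvalue rho (lambda k),
        forall j k, (1 <= j)%N -> (j < k)%N -> lambda j < lambda k,
        lambda k @[k --> \oo] --> sup [set derive1 rho y | y in `]-1, 1[%classic]
      & forall k, (1 <= k)%N -> exists wt : R -> R,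
          let w := fun z : R * R => cos (k%:R * z.1) * wt z.2 in
          sobolev_oo w /\ L_eigenfunction rho (lambda k) w].
Proof.
pose a := derive1 rho.
have ha := W_oo_oo_Ck rho'_bounded.
have [ca0 /(_ isT)[A ba0]] := Ck_C0 (ha 0%N).
have ca (t : R) : -1 < t < 1 -> {for t, continuous a}.
  by move=> tI; apply: ca0; rewrite /= in_itv.
have ba (t : R) : -1 < t < 1 -> `|a t| <= A.
  by move=> tI; apply: ba0; rewrite /= in_itv.
set S := sup _ in rho'_sup *.
have hsup : has_sup [set derive1 rho y | y in `]-1, 1[%classic].
  split; first by exists (a 0); exists 0; rewrite //= in_itv /= ltrN10 ltr01.
  by exists A => _ [y yI <-]; apply: le_trans (ler_norm _) (ba0 y yI).
have haS (t : R) : -1 < t < 1 -> a t <= S.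
  move=> tI; apply: ub_le_sup; first exact: hsup.2.
  by exists t; rewrite //= in_itv.
have hS (e : R) : e < S -> exists2 t, -1 < t < 1 & e < a t.
  move=> eS; have e0 : 0 < S - e by rewrite subr_gt0.
  have [_ [t tI <-]] := sup_adherent e0 hsup.
  by rewrite opprB addrC subrK => h; exists t => //; move: tI; rewrite /= in_itv.
have [m [phi [p [h1 h2 h3]]]] := principal_sequence ca ba rho'_sup haS hS.
have pos := hS 0 rho'_sup.
have eig k : (1 <= k)%N -> exists wt : R -> R,
    let w := fun z : R * R => cos (k%:R * z.1) * wt z.2 in
    sobolev_oo w /\ L_eigenfunction rho (m k)^-1 w.
  move=> k1; have [m0 hs phi0 phi1] := h1 k k1.
  exists (fun y => k%:R * m k * a y * phi k y) => /=.
  have -> : (fun z : R * R => cos (k%:R * z.1) * (k%:R * m k * a z.2 * phi k z.2)) =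
      tensor (trig k 1 0) (fun y => k%:R * m k * a y * phi k y).
    by apply/funext => z; rewrite /tensor /trig mul1r mul0r addr0.
  split; first exact: eigenfunction_sobolev ha hs.
  split; first exact: (eigenfunction_neq0 k1 m0 ha phi0 pos).
  exact: (eigenfunction_graph m0 ha hs phi1).
(* The value at [k = 0] is arbitrary: the guards exclude it and the limit ignores it. *)
exists (fun k => (m k)^-1); split=> //.
move=> k k1; have [m0 _ _ _] := h1 k k1.
split; first by rewrite invr_gt0.
by have [wt [_ hw]] := eig k k1; eexists; exact: hw.
Qed.
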